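(* Let $X=(X_{ij})_{i,j}$ be a symmetric $n\times n$ matrix of real-valued random variables whose entries $X_{ij}$, $i<j$, are independent and Bernoulli distributed with $$P(X_{ij}=1)=1-P(X_{ij}=0)=p(n)\in(0,1),\quad i<j,$$ and with $P(X_{ii}=0)=1$ for $i=1,\dots,n$. For any fixed $k\ge 3$ consider the trace of the $k$-th power of the matrix, $$\mathrm{Tr}(X^k)=\sum_{i_1,\dots,i_k=1}^nX_{i_1i_2}X_{i_2i_3}\cdots X_{i_ki_1}.$$ Note that $\mathrm{Tr}(X^k)=2W$, for $W$ counting circles of length $k$ in a random graph. Write $p=p(n)$. Then for any increasing sequence $(\beta_n)_n$ of positive reals with $$n^{k-1}p^{k-1}\sqrt{p(1-p)}\ \ll\ \beta_n\ \ll\ n^k\left(p^{k-1}\sqrt{p(1-p)}\right)^4,$$ the sequence $(T_n)_n$ with $$T_n:=\frac{\mathrm{Tr}(X^k)-\mathbb E[\mathrm{Tr}(X^k)]}{2\beta_n}$$ satisfies a moderate deviation principle with speed $$s_n=\frac{1}{\binom{n-2}{k-2}^2\binom n2}\,\frac{1}{p^{2k-1}(1-p)}\,\beta_n^2$$ and rate function $$I(x)=\frac{x^2}{2\left((k-2)!\right)^2},\qquad x\in\mathbb R.$$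
   Context: $u_n\ll v_n$ means $u_n/v_n\to0$ as $n\to\infty$. The random graph has $n$ vertices, with vertices $i<j$ joined by an edge if and only if $X_{ij}=1$; $W$ is the number of (not necessarily induced) subgraphs that are cycles of length $k$. Large deviation principle (LDP): a sequence of real random variables $(T_n)$ with laws $\mu_n$ satisfies the LDP with speed $s_n\nearrow\infty$ and good rate function $I$ if the level sets $\{x: I(x)\le\alpha\}$ are compact for all $\alpha\in[0,\infty)$ and for all Borel sets $\Gamma$, $$-\inf_{x\in \mathrm{int}(\Gamma)}I(x)\le\liminf_{n\to\infty}\frac1{s_n}\log\mu_n(\Gamma)\le\limsup_{n\to\infty}\frac1{s_n}\log\mu_n(\Gamma)\le-\inf_{x\in \mathrm{cl}(\Gamma)}I(x).$$ A moderate deviation principle (MDP) is formally nothing else but an LDP; the name is used when the scaling lies between that of a law of large numbers and that of a central limit theorem.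
   Formalization: Tr(X^k) is taken to be 2W (W = number of k-cycles), as noted, not the displayed closed-walk sum, which is 6W for k=3 and gives a different rate function; the speed s_n is only required to tend to infinity, since it need not be monotone for arbitrary p(n). *)

(* Defs.v *)
From HB Require Import structures.
From mathcomp Require Import all_boot all_order all_algebra.
Set Implicit Arguments.
Unset Strict Implicit.
Unset Printing Implicit Defensive.
Import Order.TTheory GRing.Theory Num.Theory.
Local Open Scope ring_scope.

Definition graph_edges (R : realFieldType) (n : nat) (A : 'M[R]_n) :
    {set {set 'I_n}} :=
  [set [set i; j] | i in 'I_n, j in 'I_n & (i < j)%N && (A i j == 1)].

(* A cycle is determined by its edge set; [ordS] is the cyclic successor.  For
   [k < 3] the edge set on the right is not that of a cycle. *)
Definition is_cycle (n k : nat) (E : {set {set 'I_n}}) : bool :=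
  [exists c : {ffun 'I_k -> 'I_n},
    injectiveb c && (E == [set [set c i; c (ordS i)] | i in 'I_k])].

Definition cycle_count (R : realFieldType) (n k : nat) (A : 'M[R]_n) : nat :=
  #|[set E : {set {set 'I_n}} | is_cycle k E & E \subset graph_edges A]|.

(* "Tr(X^k) = 2W".  In the sum of A i_1 i_2 * A i_2 i_3 * ... * A i_k i_1 over
   all index tuples every k-cycle of the graph occurs 2k times, and for k > 3
   closed walks with repeated vertices contribute as well, so [\tr (A ^+ k)] is
   not 2W.  The normalisation by 2 beta_n and the rate function
   x^2 / (2 (k-2)!^2) belong to 2W (each k-cycle counted once for each of its
   two orientations), which is therefore taken as the definition. *)
Definition cycle_trace (R : realFieldType) (n k : nat) (A : 'M[R]_n) : R :=
  2 * (cycle_count k A)%:R.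

From mathcomp Require Import all_classical all_reals all_analysis.
Import numFieldNormedType.Exports.
Local Open Scope classical_set_scope.

Definition mutually_independent (R : realType) (d : measure_display)
    (Omega : measurableType d) (P : probability Omega R) (I : finType)
    (D : {set I}) (Y : I -> Omega -> R) : Prop :=
  forall J : {set I}, J \subset D ->
  forall B : I -> set R, (forall i, measurable (B i)) ->
    P (\bigcap_(i in [set` J]) Y i @^-1` B i)
    = (\prod_(i in J) P (Y i @^-1` B i))%E.

Definition much_less (R : realType) (u v : nat -> R) : Prop :=
  (fun n => u n / v n) @ \oo --> (0 : R).

Definition good_rate_function (R : realType) (I : R -> \bar R) : Prop :=
  (forall x, (0 <= I x)%E) /\
  (forall a : R, 0 <= a -> compact [set x | (I x <= a%:E)%E]).

(* [lne] is the extended logarithm, with value -oo at 0, and the infimum over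
   the empty set is +oo.  The speed is required to diverge to +oo but not to
   be monotone in n. *)
Definition LDP (R : realType) (d : nat -> measure_display)
    (Omega : forall n, measurableType (d n))
    (P : forall n, probability (Omega n) R) (T : forall n, Omega n -> R)
    (s : nat -> R) (I : R -> \bar R) : Prop :=
  [/\ forall n, measurable_fun [set: Omega n] (T n),
      s @ \oo --> +oo%R,
      good_rate_function I &
      forall G : set R, measurable G ->
        let a n := ((s n)^-1%:E * lne (P n (T n @^-1` G)))%E in
        (- ereal_inf (I @` G°) <= limn_einf a)%E /\
        (limn_esup a <= - ereal_inf (I @` closure G))%E].

(* Main.v *)
Require Import Defs.
From HB Require Import structures.
From mathcomp Require Import all_boot all_order all_algebra.
From mathcomp Require Import all_classical all_reals all_analysis.
From mathcomp Require Import measurable_realfun.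
From mathcomp Require Import zify ring lra.
Set Implicit Arguments.
Unset Strict Implicit.
Unset Printing Implicit Defensive.
Import Order.TTheory GRing.Theory Num.Theory.
Import numFieldNormedType.Exports.
Local Open Scope classical_set_scope.
Local Open Scope ring_scope.

(** The number of k-cycles minus its mean splits into a linear part
    [L = D * \sum_e (X_e - p)], where [D = p^(k-1) (n-2)_(k-2)] is the mean
    effect of one edge, and a remainder.  The linear part is a sum of i.i.d.
    variables, so a third-order Taylor expansion of its log-Laplace transform
    gives the Gaussian rate.  The remainder is exponentially negligible: reveal
    the edges one by one; the exponential of the resulting martingale,
    compensated by its predictable quadratic variation [V], has mean at most 1,
    and [V] itself has small mean (two distinct edges lie on few common cycles)
    and bounded differences, hence a controlled exponential moment.  With
    [M = (n-2)_(k-2)] and [N = 'C(n, 2)] the errors at parameter [s / beta] are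
    of order [N ((s / beta) M)^3], which the upper bound on [beta] makes
    negligible with respect to [s].  Chernoff bounds and exponential tilting
    then give the tails, hence the principle. *)

(** Put [q ^+ 2 = p ^+ (2 * k - 1) * (1 - p)]. Bounded differences alone cannot kill the remainder:
    its increments are only known to be at most [M], and [N ((s / beta) M)^2] equals
    [(k-2)!^2 s / q^2], which is at least of order [s]. The quadratic variation is small because the
    slope [D] is the mean of the effect of an edge, so the mean of a squared increment of the
    remainder is a variance, to which only pairs of cycles sharing a further edge contribute. This
    replaces [M^2] by [k M H], with [H] the codegree bound and [H / M] of order [1 / n]. The
    resulting error [s / (n q^2)] is negligible because the two conditions on [beta] multiply to
    [n q^3 -> oo]. The fluctuation of [V] costs a fourth power of [(s / beta) M], less than the
    cubic Taylor error. That cubic error, divided by [s], is a constant times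
    [beta / ('C(n - 2, k - 2) N q^4)], whence the fourth power in the upper condition on [beta]. All
    expectations are finite sums over sets of edges. *)

Section ExponentialBounds.
Variable R : realType.

(** Multiplied by [1 - y <= expR (- y)], the right side becomes [1 + y ^+ 2 * (1 - 2 * y)], so
    [y <= 1/2] is exactly what makes it at least 1; no lower bound on [y] is required. *)
Lemma expR_le_quadratic (y : R) : y <= 2^-1 -> expR y <= 1 + y + 2 * y ^+ 2.
Proof.
move=> y12; have h1 := @expR_ge1Dx R (- y).
have h2 := expRxMexpNx_1 y.
have h3 := expR_gt0 y.
rewrite -(@ler_pM2r _ (expR (- y))) ?expR_gt0// h2.
have h4 : 0 <= 1 + y + 2 * y ^+ 2 by nra.
apply: le_trans (ler_wpM2l h4 h1); nra.
Qed.

(** Mean value theorem for the Taylor remainder [f]: its derivative [expR x - 1 - x] lies between 0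
    and [2 * x ^+ 2]. *)
Lemma expR_taylor2 (y : R) : `|y| <= 2^-1 ->
  `|expR y - (1 + y + y ^+ 2 / 2)| <= 2 * `|y| ^+ 3.
Proof.
move=> y12.
pose f (x : R) := expR x - (1 + x + x ^+ 2 / 2).
pose df (x : R) := expR x - (1 + x).
have fd (x : R) : is_derive x 1 f (df x).
  apply: is_derive_eq.
  rewrite /df /GRing.scale /=; lra.
have fc : continuous f.
  by move=> x; apply/differentiable_continuous/derivable1_diffP; exact: ex_derive.
have dfle (x : R) : `|x| <= `|y| -> `|df x| <= 2 * `|y| ^+ 2.
  move=> xy; have h1 := @expR_ge1Dx R x.
  have h2 : expR x <= 1 + x + 2 * x ^+ 2.
    by apply: expR_le_quadratic; apply: le_trans (ler_norm _) (le_trans xy y12).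
  rewrite ger0_norm /df ?subr_ge0//.
  have : x ^+ 2 <= `|y| ^+ 2 by rewrite -real_normK ?num_real// lerXn2r ?nnegrE.
  by lra.
have f0 : f 0 = 0 by rewrite /f expR0; lra.
have [y0|y0] := leP 0 y.
  have [c] := MVT_segment y0 (fun x _ => fd x) (continuous_subspaceT fc).
  rewrite in_itv/= => /andP[c0 cy].
  rewrite f0 !subr0 -/(f y) => ->; rewrite normrM exprSr mulrA.
  by apply: ler_wpM2r => //; apply: dfle; rewrite !ger0_norm.
have [c] := MVT_segment (ltW y0) (fun x _ => fd x) (continuous_subspaceT fc).
rewrite in_itv/= => /andP[cy c0].
rewrite f0 !sub0r -/(f y) => /eqP; rewrite eqr_oppLR => /eqP ->.
rewrite normrN normrM exprSr mulrA normrN.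
by apply: ler_wpM2r => //; apply: dfle; rewrite !ler0_norm ?lerN2// ltW.
Qed.

Lemma bernoulli_mgf_centered_le (p g : R) : 0 <= p <= 1 -> `|g| <= 2^-1 ->
  p * expR ((1 - p) * g) + (1 - p) * expR (- p * g) <= expR (g ^+ 2).
Proof.
move=> /andP[p0 p1]; rewrite ler_norml => /andP[gl gu].
have h1 : expR ((1 - p) * g) <= 1 + (1 - p) * g + 2 * ((1 - p) * g) ^+ 2.
  by apply: expR_le_quadratic; nra.
have h2 : expR (- p * g) <= 1 + (- p * g) + 2 * (- p * g) ^+ 2.
  by apply: expR_le_quadratic; nra.
apply: le_trans (expR_ge1Dx _).
have q0 : 0 <= 1 - p by lra.
have h3 := ler_wpM2l p0 h1; have h4 := ler_wpM2l q0 h2.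
apply: le_trans (lerD h3 h4) _.
have : 0 <= g ^+ 2 * (1 - 2 * p * (1 - p)) by apply: mulr_ge0; nra.
lra.
Qed.

(** Centring cancels the linear terms, and the Taylor errors average to at most [2 * |m|^3]. The
    constant 4 leaves room for returning from [1 + z] to an exponential: the loss [2 * z ^+ 2] is of
    order [m ^+ 4], and [|m| <= 1/8] turns it into a small multiple of [|m|^3]. *)
Lemma bernoulli_mgf_gauss (p m : R) : 0 <= p <= 1 -> `|m| <= 8^-1 ->
  expR (m ^+ 2 / 2 * (p * (1 - p)) - 4 * `|m| ^+ 3)
    <= p * expR (m * (1 - p)) + (1 - p) * expR (- (m * p))
    <= expR (m ^+ 2 / 2 * (p * (1 - p)) + 4 * `|m| ^+ 3).
Proof.
move=> /andP[p0 p1] hm; set c := (X in _ <= X <= _).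
set v := p * (1 - p).
have v0 : 0 <= v by apply: mulr_ge0; lra.
have v4 : v <= 4^-1 by have := sqr_ge0 (p - 2^-1); rewrite /v; lra.
set a := `|m|.
have a0 : 0 <= a by exact: normr_ge0.
have m2 : m ^+ 2 = a ^+ 2 by rewrite real_normK ?num_real.
have q0 : 0 <= 1 - p by lra.
have t1 : `|expR (m * (1 - p)) - (1 + m * (1 - p) + (m * (1 - p)) ^+ 2 / 2)| <= 2 * a ^+ 3.
  have b : `|m * (1 - p)| <= a by rewrite normrM (ger0_norm q0); apply: ler_piMr => //; lra.
  apply: le_trans (expR_taylor2 _) _; first (apply: le_trans b _; apply: le_trans hm _; lra).
  by rewrite ler_pM2l// lerXn2r ?nnegrE.
have t2 : `|expR (- (m * p)) - (1 + (- (m * p)) + (- (m * p)) ^+ 2 / 2)| <= 2 * a ^+ 3.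
  have b : `|- (m * p)| <= a by rewrite normrN normrM (ger0_norm p0); apply: ler_piMr.
  apply: le_trans (expR_taylor2 _) _; first (apply: le_trans b _; apply: le_trans hm _; lra).
  by rewrite ler_pM2l// lerXn2r ?nnegrE.
move: t1 t2; rewrite !ler_norml => /andP[l1 u1] /andP[l2 u2].
have := ler_wpM2l p0 l1; have := ler_wpM2l p0 u1.
have := ler_wpM2l q0 l2; have := ler_wpM2l q0 u2 => {l1 l2 u1 u2} u2 l2 u1 l1.
have cu : c <= 1 + (a ^+ 2 / 2 * v + 2 * a ^+ 3) by rewrite -m2 /c /v; lra.
have cl : 1 + (a ^+ 2 / 2 * v - 2 * a ^+ 3) <= c by rewrite -m2 /c /v; lra.
have a3 : 0 <= a ^+ 3 by rewrite exprn_ge0.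
rewrite m2; apply/andP; split; last first.
  by apply: le_trans cu (le_trans (expR_ge1Dx _) _); rewrite ler_expR; lra.
apply: le_trans cl.
set z := a ^+ 2 / 2 * v - 2 * a ^+ 3.
(* [1 + z >= exp (z - 2 z^2)], from [exp (-w) >= 1 - w] at [w = z - 2 z^2]. *)
have a2 : a ^+ 2 <= 64^-1.
  rewrite (_ : 64^-1 = 8^-1 ^+ 2); last by field.
  by rewrite lerXn2r ?nnegrE.
have a2' : 0 <= a ^+ 2 by rewrite exprn_ge0.
have a3u : a ^+ 3 <= a ^+ 2 / 8.
  by rewrite exprSr ler_wpM2l.
have zl : - (a ^+ 2 / 4) <= z by rewrite /z; have := mulr_ge0 a2' v0; lra.
have zu : z <= a ^+ 2 / 4 by rewrite /z; have := ler_wpM2l a2' v4; lra.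
have z2 : z ^+ 2 <= a ^+ 4 / 16.
  rewrite -[z ^+ 2]real_normK ?num_real//.
  rewrite (_ : a ^+ 4 / 16 = (a ^+ 2 / 4) ^+ 2); last by field.
  by rewrite lerXn2r ?nnegrE ?ler_norml ?zl//; lra.
have a4 : a ^+ 4 <= a ^+ 3 / 8 by rewrite exprSr ler_wpM2l.
apply: (@le_trans _ _ (expR (z - 2 * z ^+ 2))).
  by rewrite ler_expR /z -/z; rewrite -/z in z2; have : z = a ^+ 2 / 2 * v - 2 * a ^+ 3 by []; lra.
have z1 : 0 <= 1 + z by lra.
set w := z - 2 * z ^+ 2.
rewrite -[leLHS]mul1r -ler_pdivlMr ?expR_gt0// -expRN.
apply: le_trans (ler_wpM2l z1 (expR_ge1Dx (- w))).
have : z ^+ 2 * (1 + 2 * z) >= 0 by apply: mulr_ge0; [exact: sqr_ge0|lra].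
rewrite /w; lra.
Qed.

End ExponentialBounds.

(** * Martingale and exponential moment bounds on a finite Bernoulli product space *)

Section ProductSpace.
Variables (R : realType) (I : finType) (p : R).
Hypothesis p01 : 0 <= p <= 1.
Implicit Types (f g : {set I} -> R) (x : {set I}) (i j : I) (l : seq I).

(** A subset of [I] encodes a 0/1 vector. [avg i] is conditional expectation given all coordinates
    but [i], and [diff i] is the discrete derivative in coordinate [i]. In [avgs l] the head of [l]
    is averaged last, so it is the coordinate revealed first. *)
Definition avg i f x : R := p * f (i |: x)%SET + (1 - p) * f (x :\ i)%SET.
Definition diff i f x : R := f (i |: x)%SET - f (x :\ i)%SET.
Definition avgs l f : {set I} -> R := foldr avg f l.

(* The predictable quadratic variation, up to the factor [p (1 - p)], of the
   martingale that reveals the coordinates listed in [l] one by one. *)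
Fixpoint qvar l f x : R :=
  if l is i :: l' then diff i (avgs l' f) x ^+ 2 + qvar l' f x else 0.

Definition invariant i f := forall x, f (i |: x)%SET = f (x :\ i)%SET.

Let p0 : 0 <= p. Proof. by case/andP: p01. Qed.
Let q0 : 0 <= 1 - p. Proof. by rewrite subr_ge0; case/andP: p01. Qed.

Lemma invariantU1 i f x : invariant i f -> f (i |: x)%SET = f x.
Proof.
move=> fi; have [xi|xi] := boolP (i \in x).
  by rewrite (finset.setUidPr _) ?finset.sub1set.
rewrite fi; congr f; apply/setP => j; rewrite !inE.
by case: eqP => // ->; rewrite (negbTE xi).
Qed.

Lemma invariantD1 i f x : invariant i f -> f (x :\ i)%SET = f x.
Proof. by move=> fi; rewrite -fi; exact: invariantU1. Qed.

Lemma avg_invariantM i f g x : invariant i f ->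
  avg i (fun y => f y * g y) x = f x * avg i g x.
Proof. by move=> fi; rewrite /avg invariantU1// invariantD1//; ring. Qed.

Lemma avg_cst i (c : R) x : avg i (fun=> c) x = c.
Proof. by rewrite /avg; ring. Qed.

Lemma le_avg i f g x : (forall y, f y <= g y) -> avg i f x <= avg i g x.
Proof. by move=> fg; apply: lerD; apply: ler_wpM2l. Qed.

Lemma eq_avgs l f g : f =1 g -> avgs l f =1 avgs l g.
Proof. by move=> fg; elim: l => //= i l ih x; rewrite /avg !ih. Qed.

Lemma le_avgs l f g x : (forall y, f y <= g y) -> avgs l f x <= avgs l g x.
Proof. by move=> fg; elim: l x => //= i l ih x; exact: le_avg. Qed.

Lemma avgs_invariantM l f g x : (forall i, i \in l -> invariant i f) ->
  avgs l (fun y => f y * g y) x = f x * avgs l g x.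
Proof.
elim: l x => //= i l ih x fl.
rewrite {1}/avg !ih; try by move=> j jl; apply: fl; rewrite inE jl orbT.
by rewrite -(@avg_invariantM i f) //; apply: fl; rewrite inE eqxx.
Qed.

Lemma toggle_comm i j x : i != j ->
  [/\ (i |: (j |: x) = j |: (i |: x))%SET,
      (i |: (x :\ j) = (i |: x) :\ j)%SET,
      ((j |: x) :\ i = j |: (x :\ i))%SET &
      (x :\ j :\ i = x :\ i :\ j)%SET].
Proof.
move=> ij; split; apply/setP => z; rewrite !inE;
  case: (eqVneq z i) => [->|]; case: (eqVneq _ j) => //=; rewrite ?(negbTE ij)//.
all: by move=> e; rewrite e eqxx in ij.
Qed.

Lemma toggle_idem i x :
  [/\ (i |: (i |: x) = i |: x)%SET,
      (i |: (x :\ i) = i |: x)%SET,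
      ((i |: x) :\ i = x :\ i)%SET &
      (x :\ i :\ i = x :\ i)%SET].
Proof. by split; apply/setP => z; rewrite !inE; case: (eqVneq z i). Qed.

Lemma invariant_avg i f : invariant i (avg i f).
Proof. by move=> x; have [h1 h2 h3 h4] := toggle_idem i x; rewrite /avg h1 h2 h3 h4. Qed.

Lemma invariant_diff i f : invariant i (diff i f).
Proof. by move=> x; have [h1 h2 h3 h4] := toggle_idem i x; rewrite /diff h1 h2 h3 h4. Qed.

Lemma diff_invariant i f x : invariant i f -> diff i f x = 0.
Proof. by rewrite /diff => ->; rewrite subrr. Qed.

Lemma invariant_avgW j i f : invariant j f -> invariant j (avg i f).
Proof.
have [->|ij] := eqVneq i j; first by move=> _; exact: invariant_avg.
move=> fj x; have [h1 h2 h3 h4] := toggle_comm x ij.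
by rewrite /avg h1 h2 h3 h4 !fj.
Qed.

Lemma invariant_diffW j i f : invariant j f -> invariant j (diff i f).
Proof.
have [->|ij] := eqVneq i j; first by move=> _; exact: invariant_diff.
move=> fj x; have [h1 h2 h3 h4] := toggle_comm x ij.
by rewrite /diff h1 h2 h3 h4 !fj.
Qed.

Lemma invariant_avgs l f j : j \in l -> invariant j (avgs l f).
Proof.
elim: l => //= i l ih; rewrite inE => /predU1P[->|jl].
  exact: invariant_avg.
exact/invariant_avgW/ih.
Qed.

Lemma diff_avg i j f x : i != j -> diff i (avg j f) x = avg j (diff i f) x.
Proof.
move=> ij; have [h1 h2 h3 h4] := toggle_comm x ij.
by rewrite /diff /avg h1 h2 h3 h4; ring.
Qed.

Lemma diff_avg_bounded i j f (c : R) : (forall x, `|diff i f x| <= c) ->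
  forall x, `|diff i (avg j f) x| <= c.
Proof.
move=> fc x; have [->|ij] := eqVneq i j.
  by rewrite diff_invariant ?normr0 ?(le_trans _ (fc x))//; exact: invariant_avg.
rewrite diff_avg// ler_norml; apply/andP; split.
  rewrite -[leLHS](avg_cst j _ x); apply: le_avg => y.
  by have := fc y; rewrite ler_norml => /andP[].
rewrite -[leRHS](avg_cst j _ x); apply: le_avg => y.
by have := fc y; rewrite ler_norml => /andP[].
Qed.

Lemma diff_avgs_bounded i l f (c : R) : (forall x, `|diff i f x| <= c) ->
  forall x, `|diff i (avgs l f) x| <= c.
Proof. by move=> fc; elim: l => //= j l ih x; exact: diff_avg_bounded. Qed.

(** [diff i] commutes with averaging over any other coordinate and kills an average over [i] itself,
    so averaging never increases a bound on iterated differences. *)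
Lemma diff2_avgs_bounded i j l f (c : R) :
  (forall x, `|diff j (diff i f) x| <= c) ->
  forall x, `|diff j (diff i (avgs l f)) x| <= c.
Proof.
move=> fc; elim: l => //= a l ih x; have [ai|ai] := eqVneq i a.
  have h0 y : diff i (avg a (avgs l f)) y = 0.
    by rewrite ai diff_invariant//; exact: invariant_avg.
  by rewrite {1}/diff !h0 subr0 normr0 (le_trans _ (ih x)).
rewrite {1}/diff !diff_avg// -/(diff j (avg a (diff i (avgs l f))) x).
exact: diff_avg_bounded.
Qed.

Lemma avg_exp_le i f (s : R) x : `|s * diff i f x| <= 2^-1 ->
  avg i (fun y => expR (s * (f y - avg i f x))) x <= expR (s ^+ 2 * diff i f x ^+ 2).
Proof.
move=> h; rewrite -exprMn; apply: le_trans (bernoulli_mgf_centered_le p01 h).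
by apply: lerD; apply: ler_wpM2l => //; rewrite ler_expR /avg /diff le_eqVlt;
  apply/orP; left; apply/eqP; ring.
Qed.

(* Exponential supermartingale bound: the conditional mgf of each martingale
   increment is absorbed by the matching term of the quadratic variation. *)
Lemma avgs_exp_compensated_le l f (s : R) x :
  (forall i y, `|s * diff i f y| <= 2^-1) ->
  avgs l (fun y => expR (s * (f y - avgs l f y) - s ^+ 2 * qvar l f y)) x <= 1.
Proof.
move=> fs.
have fs' i l' y : `|s * diff i (avgs l' f) y| <= 2^-1.
  have [->|s0] := eqVneq s 0; first by rewrite mul0r normr0.
  rewrite normrM -ler_pdivlMl ?normr_gt0//; apply: diff_avgs_bounded => z.
  by rewrite ler_pdivlMl ?normr_gt0// -normrM.
elim: l x => [|i l ih] x /=; first by rewrite subrr !mulr0 subrr expR0.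
set F := avgs l f.
pose G y := expR (s * (F y - avg i F y) - s ^+ 2 * diff i F y ^+ 2).
pose H y := expR (s * (f y - F y) - s ^+ 2 * qvar l f y).
(* [G] is built from [F], which no longer depends on the coordinates of [l]; it leaves the inner
   average, and the induction hypothesis bounds what remains by 1. *)
have GE y : avgs l (fun z => G z * H z) y = G y * avgs l H y.
  apply: avgs_invariantM => j jl z; rewrite /G.
  have Fj : invariant j F by exact: invariant_avgs.
  by rewrite Fj (invariant_avgW i Fj) (invariant_diffW i Fj).
apply: (@le_trans _ _ (avg i G x)).
  apply: le_avg => y; rewrite (@eq_avgs l _ (fun z => G z * H z)).
    by rewrite GE ler_piMr ?expR_ge0//; exact: ih.
  by move=> z; rewrite /G /H -expRD; congr expR; rewrite -/F; ring.
(* The compensator is predictable: [diff i F] does not see coordinate [i], so [K] leaves the average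
   over [i] and cancels the bound of [avg_exp_le]. *)
pose K y := expR (- (s ^+ 2 * diff i F y ^+ 2)).
have Ki : invariant i K by move=> y; rewrite /K invariant_diff.
have -> : avg i G x = avg i (fun y => K y * expR (s * (F y - avg i F x))) x.
  have FA := invariant_avg i F.
  rewrite /avg -!/(avg i F _).
  rewrite /G /K -!expRD (invariantU1 x FA) (invariantD1 x FA).
  by congr (_ * expR _ + _ * expR _); rewrite addrC.
rewrite avg_invariantM//.
apply: le_trans (ler_wpM2l (expR_ge0 _) (avg_exp_le (fs' i l x))) _.
by rewrite -expRD addNr expR0.
Qed.

Definition weight x : R := \prod_i (if i \in x then p else 1 - p).

Definition Ex f : R := \sum_(x : {set I}) weight x * f x.

Lemma weight_ge0 x : 0 <= weight x.
Proof. by apply: prodr_ge0 => i _; case: ifP. Qed.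

Lemma sum_set_prod (F G : I -> R) :
  \sum_(x : {set I}) \prod_i (if i \in x then F i else G i)
  = \prod_i (F i + G i).
Proof.
have -> : \prod_i (F i + G i) = \prod_i \sum_(b : bool) (if b then F i else G i).
  by apply: eq_bigr => i _; rewrite big_bool.
rewrite bigA_distr_bigA /=.
rewrite (reindex (fun f : {ffun I -> bool} => [set i | f i]%SET)) /=; last first.
  exists (fun x : {set I} => [ffun i => i \in x]).
    by move=> f _; apply/ffunP => i; rewrite ffunE inE.
  by move=> x _; apply/setP => i; rewrite inE ffunE.
by apply: eq_bigr => f _; apply: eq_bigr => i _; rewrite inE.
Qed.

Lemma Ex_prod (F G : I -> R) :
  Ex (fun x => \prod_i (if i \in x then F i else G i))
  = \prod_i (p * F i + (1 - p) * G i).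
Proof.
rewrite -sum_set_prod; apply: eq_bigr => x _.
by rewrite /weight -big_split; apply: eq_bigr => i _ /=; case: ifP.
Qed.

Lemma sum_weight : \sum_x weight x = 1.
Proof.
by rewrite sum_set_prod big1// => i _; rewrite addrC subrK.
Qed.

Lemma Ex_cst (c : R) : Ex (fun=> c) = c.
Proof. by rewrite /Ex -big_distrl /= sum_weight mul1r. Qed.

Lemma eq_Ex f g : f =1 g -> Ex f = Ex g.
Proof. by move=> fg; apply: eq_bigr => x _; rewrite fg. Qed.

Lemma ExD f g : Ex (fun x => f x + g x) = Ex f + Ex g.
Proof. by rewrite -big_split; apply: eq_bigr => x _; rewrite mulrDr. Qed.

Lemma ExZ (c : R) f : Ex (fun x => c * f x) = c * Ex f.
Proof. by rewrite big_distrr; apply: eq_bigr => x _ /=; rewrite mulrCA. Qed.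

Lemma ExB f g : Ex (fun x => f x - g x) = Ex f - Ex g.
Proof.
rewrite ExD; congr (_ + _); rewrite -mulN1r -ExZ.
by apply: eq_Ex => x; rewrite mulN1r.
Qed.

Lemma Ex_sum (J : Type) (r : seq J) (Q : pred J) (F : J -> {set I} -> R) :
  Ex (fun x => \sum_(j <- r | Q j) F j x) = \sum_(j <- r | Q j) Ex (F j).
Proof.
rewrite exchange_big /=; apply: eq_bigr => x _.
by rewrite big_distrr.
Qed.

Lemma le_Ex f g : (forall x, f x <= g x) -> Ex f <= Ex g.
Proof. by move=> fg; apply: ler_sum => x _; rewrite ler_wpM2l ?weight_ge0. Qed.

(** Subsets are paired as [x] containing [i] and [x] without [i]. Their weights are [p] and [1 - p]
    times a common factor, and [avg i f] takes the same value on both. *)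
Lemma Ex_avg i f : Ex (avg i f) = Ex f.
Proof.
pose w' (x : {set I}) := \prod_(j | j != i) (if j \in x then p else 1 - p).
have wE x : weight x = (if i \in x then p else 1 - p) * w' x.
  by rewrite /weight (bigD1 i).
have w'U x : w' (i |: x)%SET = w' x.
  by apply: eq_bigr => j ji; rewrite !inE (negbTE ji).
have w'D x : w' (x :\ i)%SET = w' x.
  by apply: eq_bigr => j ji; rewrite !inE ji.
have split_sum (h : {set I} -> R) :
    \sum_x h x = \sum_(x : {set I} | i \in x) (h x + h (x :\ i)%SET).
  rewrite (bigID (fun x : {set I} => i \in x)) /= big_split; congr (_ + _).
  rewrite (reindex_onto (fun x : {set I} => x :\ i) (fun x => i |: x))%SET /=.
    apply: eq_bigl => x; rewrite !inE eqxx /=.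
    have [ix|ix] := boolP (i \in x); first by rewrite finset.setD1K// eqxx.
    by apply/negbTE; apply: contra ix => /eqP <-; rewrite !inE eqxx.
  by move=> x ix; rewrite finset.setU1K.
rewrite /Ex !split_sum; apply: eq_bigr => x ix.
have [_ h2 _ h4] := toggle_idem i x.
rewrite !wE !inE ix eqxx /= w'D /avg h2 h4.
rewrite (_ : i |: x = x)%SET; last by apply/finset.setUidPr; rewrite finset.sub1set.
ring.
Qed.

Lemma invariant_const f x y : (forall i, invariant i f) -> f x = f y.
Proof.
move=> fi; suff H n : forall z : {set I}, #|z| = n -> f z = f finset.set0.
  by rewrite (H _ x erefl) (H _ y erefl).
elim: n => [z /eqP|n ih z zn]; first by rewrite cards_eq0 => /eqP ->.
have /card_gt0P[i iz] : (0 < #|z|)%N by rewrite zn.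
rewrite -(invariantD1 z (fi i)); apply: ih.
by move: zn; rewrite (cardsD1 i) iz => -[].
Qed.

(** Once every coordinate has been averaged the function is constant, hence equal to its own mean,
    and averaging preserves the mean. *)
Lemma avgs_enum f x : avgs (enum I) f x = Ex f.
Proof.
have -> : Ex f = Ex (avgs (enum I) f).
  by elim: (enum I) => //= i l ->; rewrite Ex_avg.
rewrite -[LHS]Ex_cst; apply: eq_Ex => y; apply: invariant_const => i.
by apply: invariant_avgs; rewrite mem_enum.
Qed.

Lemma Ex_exp_compensated_le f (s : R) :
  (forall i y, `|s * diff i f y| <= 2^-1) ->
  Ex (fun y => expR (s * (f y - Ex f) - s ^+ 2 * qvar (enum I) f y)) <= 1.
Proof.
move=> h; rewrite -(avgs_enum _ finset.set0).
apply: le_trans (avgs_exp_compensated_le (enum I) finset.set0 h).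
by apply: le_avgs => y; rewrite avgs_enum.
Qed.

(** Azuma-type bound: the differences bound the quadratic variation by a deterministic sum, so the
    compensator can be taken out of the expectation. It is applied later to the quadratic variation
    of the remainder. *)
Lemma Ex_exp_bounded_le f (c : I -> R) (s : R) :
  (forall i y, `|diff i f y| <= c i) -> (forall i, `|s| * c i <= 2^-1) ->
  Ex (fun y => expR (s * (f y - Ex f))) <= expR (s ^+ 2 * \sum_i c i ^+ 2).
Proof.
move=> fc sc.
have qv l y : qvar l f y <= \sum_(i <- l) c i ^+ 2.
  elim: l => [|i l ih] /=; first by rewrite big_nil.
  rewrite big_cons lerD//; rewrite -real_normK ?num_real// lerXn2r ?nnegrE//.
    by apply: le_trans (fc i y).
  exact: diff_avgs_bounded.
rewrite -[leRHS]mul1r -ler_pdivrMr ?expR_gt0// -expRN mulrC -ExZ.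
apply: (le_trans _ (@Ex_exp_compensated_le f s _)).
  apply: le_Ex => y; rewrite -expRD ler_expR addrC lerD2l lerN2.
  by rewrite ler_wpM2l ?sqr_ge0//; have := qv (enum I) y; rewrite big_enum.
by move=> i y; rewrite normrM (le_trans _ (sc i))// ler_wpM2l.
Qed.

(* [2 exp F <= exp a exp (2 F - G) + exp (G - a)] replaces the
   Cauchy-Schwarz inequality in [E exp F <= (E exp (2F - G) E exp G)^(1/2)]. *)
Lemma Ex_exp_quadratic_le f (s a : R) :
  (forall i y, `|2 * s * diff i f y| <= 2^-1) ->
  Ex (fun y => expR (4 * s ^+ 2 * qvar (enum I) f y)) <= expR (2 * a) ->
  Ex (fun y => expR (s * (f y - Ex f))) <= expR a.
Proof.
move=> h1 h2.
rewrite -(@ler_pM2l _ 2)// -ExZ.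
have h3 := Ex_exp_compensated_le h1.
apply: (@le_trans _ _ (Ex (fun y =>
   expR a * expR (2 * s * (f y - Ex f) - (2 * s) ^+ 2 * qvar (enum I) f y)
   + expR (- a) * expR (4 * s ^+ 2 * qvar (enum I) f y)))).
  apply: le_Ex => y; set u := s * _; set v := 4 * s ^+ 2 * _.
  have -> : 2 * s * (f y - Ex f) - (2 * s) ^+ 2 * qvar (enum I) f y = 2 * u - v.
    by rewrite /u /v; ring.
  rewrite -!expRD.
  have E1 : expR (a + (2 * u - v)) = expR ((a + (2 * u - v)) / 2) ^+ 2.
    by rewrite -expRM_natl; congr expR; field.
  have E2 : expR (- a + v) = expR ((- a + v) / 2) ^+ 2.
    by rewrite -expRM_natl; congr expR; field.
  have E3 : expR u = expR ((a + (2 * u - v)) / 2) * expR ((- a + v) / 2).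
    by rewrite -expRD; congr expR; field.
  rewrite E1 E2 E3 -subr_ge0.
  have := sqr_ge0 (expR ((a + (2 * u - v)) / 2) - expR ((- a + v) / 2)); lra.
rewrite ExD !ExZ.
have h4 : expR (- a) * Ex (fun y => expR (4 * s ^+ 2 * qvar (enum I) f y)) <= expR a.
  apply: le_trans (ler_wpM2l (expR_ge0 _) h2) _.
  by rewrite -expRD ler_expR le_eqVlt; apply/orP; left; apply/eqP; ring.
have h5 := ler_wpM2l (expR_ge0 a) h3; lra.
Qed.

(** A difference of squares factors into a second-order difference, bounded by [c i j], and a sum of
    two first-order differences, bounded by [2 * B]. *)
Lemma diff_qvar_bounded (B : R) (c : I -> I -> R) f j l x :
  (forall i y, `|diff i f y| <= B) ->
  (forall i y, `|diff j (diff i f) y| <= c i j) ->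
  `|diff j (qvar l f) x| <= 2 * B * \sum_(i <- l) c i j.
Proof.
move=> fB fc; elim: l => [|i l ih] /=.
  by rewrite /diff subrr normr0 big_nil mulr0.
rewrite big_cons mulrDr.
set g := diff i (avgs l f).
have -> : diff j (fun x => g x ^+ 2 + qvar l f x) x
    = diff j g x * (g (j |: x)%SET + g (x :\ j)%SET) + diff j (qvar l f) x.
  by rewrite /diff; ring.
apply: le_trans (ler_normD _ _) _; apply: lerD ih.
rewrite normrM mulrC; apply: ler_pM => //.
  apply: le_trans (ler_normD _ _) _; rewrite mulr2n mulrDl mul1r.
  by apply: lerD; apply: diff_avgs_bounded.
exact: diff2_avgs_bounded.
Qed.

Lemma avg_sqr_le i f x : avg i f x ^+ 2 <= avg i (fun y => f y ^+ 2) x.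
Proof.
rewrite /avg -subr_ge0; set u := f _; set v := f _.
have -> : p * u ^+ 2 + (1 - p) * v ^+ 2 - (p * u + (1 - p) * v) ^+ 2
   = p * (1 - p) * (u - v) ^+ 2 by ring.
by rewrite mulr_ge0 ?sqr_ge0// mulr_ge0.
Qed.

(** Jensen: conditional expectation contracts the second moment. *)
Lemma Ex_diff_avgs_sqr_le i l f :
  Ex (fun x => diff i (avgs l f) x ^+ 2) <= Ex (fun x => diff i f x ^+ 2).
Proof.
elim: l => //= j l ih; apply: le_trans ih.
have [ij|ij] := eqVneq i j.
  apply: le_Ex => x; rewrite ij diff_invariant ?expr0n ?sqr_ge0//.
  exact: invariant_avg.
rewrite -[leRHS](Ex_avg j); apply: le_Ex => x; rewrite diff_avg//.
exact: avg_sqr_le.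
Qed.

Lemma Ex_qvar_le l f :
  Ex (qvar l f) <= \sum_(i <- l) Ex (fun x => diff i f x ^+ 2).
Proof.
elim: l => [|i l ih] /=; first by rewrite big_nil Ex_cst.
by rewrite ExD big_cons lerD// Ex_diff_avgs_sqr_le.
Qed.

Lemma Ex_subset (S : {set I}) : Ex (fun x => (S \subset x)%:R) = p ^+ #|S|.
Proof.
pose F i : R := if i \in S then 0 else 1.
have -> : Ex (fun x => (S \subset x)%:R)
    = Ex (fun x => \prod_i (if i \in x then 1 else F i)).
  apply: eq_Ex => x; have [Sx|/fintype.subsetPn[i iS ix]] := boolP (S \subset x).
    rewrite big1// => i _; case: ifP => // ix; rewrite /F ifN//.
    by apply: contraFN ix; exact: (fintype.subsetP Sx).
  by rewrite (bigD1 i) //= (negbTE ix) /F iS mul0r.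
rewrite Ex_prod (bigID (mem S)) /= [X in _ * X]big1 ?mulr1; last first.
  by move=> i /negbTE iS; rewrite /F iS; ring.
rewrite -prodr_const; apply: eq_bigr => i iS; rewrite /F iS; ring.
Qed.

End ProductSpace.

(** * Hyperedges of a regular uniform hypergraph inside a random set of vertices *)

Section HypergraphCount.
Variables (R : realType) (I : finType) (p : R).
Hypothesis p01 : 0 <= p <= 1.
Variables (F : {set {set I}}) (k M H : nat).
Hypothesis k_gt0 : (0 < k)%N.
Hypothesis cardF : forall S, S \in F -> #|S| = k.
Hypothesis degF : forall i, #|[set S in F | i \in S]%SET| = M.
Hypothesis codegF : forall i j, i != j ->
  (#|[set S in F | (i \in S) && (j \in S)]%SET| <= H)%N.
Implicit Types (x S : {set I}) (i j : I).

Local Notation Ex := (Ex p).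

Definition hcount x : R := \sum_(S in F) (S \subset x)%:R.
Definition hslope : R := p ^+ (k - 1) * M%:R.
Definition hlin x : R := \sum_(i : I) hslope * ((i \in x)%:R - p).
Definition hrem x : R := hcount x - Ex hcount - hlin x.

Let p0 : 0 <= p. Proof. by case/andP: p01. Qed.
Let p1 : p <= 1. Proof. by case/andP: p01. Qed.

Lemma diff_subset i S x :
  diff i (fun y => (S \subset y)%:R : R) x = (i \in S)%:R * (S :\ i \subset x)%:R.
Proof.
rewrite /diff subsetD1 subDset.
have [iS|iS] := boolP (i \in S); rewrite ?andbF ?andbT ?subr0 ?mul1r// mul0r.
rewrite -subDset (_ : S :\: [set i] = S)%SET ?subrr//.
by apply/setP => j; rewrite !inE; case: eqP => // ->; rewrite (negbTE iS).
Qed.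

Lemma diff_sum (J : Type) (r : seq J) (Q : pred J) (G : J -> {set I} -> R) i x :
  diff i (fun y => \sum_(j <- r | Q j) G j y) x = \sum_(j <- r | Q j) diff i (G j) x.
Proof. by rewrite /diff -sumrB. Qed.

Lemma diff_hcount i x :
  diff i hcount x = \sum_(S in F | i \in S) (S :\ i \subset x)%SET%:R.
Proof.
rewrite /hcount diff_sum [RHS]big_mkcondr /=; apply: eq_bigr => S _.
by rewrite diff_subset; case: (i \in S); rewrite ?mul1r ?mul0r.
Qed.

Lemma sum_deg i : \sum_(S in F | i \in S) (1 : R) = M%:R.
Proof.
rewrite -(degF i) -sum1_card natr_sum; apply: eq_bigl => S.
by rewrite !inE.
Qed.

Lemma diff_hcount_ge0_le i x : 0 <= diff i hcount x <= M%:R.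
Proof.
rewrite diff_hcount sumr_ge0//= -(sum_deg i).
by apply: ler_sum => S _; rewrite lern1 leq_b1.
Qed.

Lemma hslope_ge0_le : 0 <= hslope <= M%:R.
Proof. by rewrite /hslope mulr_ge0 ?exprn_ge0//= ler_piMl// exprn_ile1. Qed.

Lemma diff_hlin i x : diff i hlin x = hslope.
Proof.
rewrite /hlin diff_sum (bigD1 i)//= big1 ?addr0 /diff.
  by rewrite !inE eqxx /=; ring.
by move=> j ji; rewrite !inE (negbTE ji) /= subrr.
Qed.

Lemma diff_hrem i x : diff i hrem x = diff i hcount x - hslope.
Proof. by rewrite -(diff_hlin i x) /diff /hrem; ring. Qed.

(** Both [diff i hcount] and the slope lie in the interval from 0 to [M], so their difference is
    bounded by [M] and not merely by [2 M]. *)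
Lemma diff_hrem_bounded i x : `|diff i hrem x| <= M%:R.
Proof.
have /andP[h1 h2] := diff_hcount_ge0_le i x; have /andP[h3 h4] := hslope_ge0_le.
by rewrite diff_hrem ler_norml; apply/andP; split; lra.
Qed.

(** Removing [i] from [S] makes the diagonal zero, in agreement with the vanishing of a repeated
    difference in one coordinate; row sums are then [(k - 1) M]. *)
Definition codeg i j : R := \sum_(S in F | i \in S) (j \in S :\ i)%SET%:R.

Lemma codeg_le i j : codeg i j <= H%:R.
Proof.
rewrite /codeg; have [->|ij] := eqVneq i j.
  by rewrite big1 ?ler0n// => S _; rewrite !inE eqxx.
apply: (@le_trans _ _ (#|[set S in F | (i \in S) && (j \in S)]%SET|)%:R); last first.
  by rewrite ler_nat codegF.
rewrite -sum1_card natr_sum [leRHS](eq_bigl (fun S => ((S \in F) && (i \in S)) && (j \in S))).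
  by rewrite [leRHS]big_mkcondr; apply: ler_sum => S _; rewrite !inE eq_sym ij; case: (j \in S).
by move=> S; rewrite !inE andbA.
Qed.

Lemma sum_cardD1 i S : S \in F -> i \in S ->
  \sum_(j : I) (j \in S :\ i)%SET%:R = k.-1%:R :> R.
Proof.
move=> SF iS; have := cardF SF; rewrite (cardsD1 i) iS => <- /=.
rewrite -sum1_card natr_sum [RHS]big_mkcond; apply: eq_bigr => j _.
by case: (j \in _).
Qed.

Lemma codegC i j : codeg i j = codeg j i.
Proof.
rewrite /codeg [LHS]big_mkcondr [RHS]big_mkcondr; apply: eq_bigr => S _.
by rewrite !inE eq_sym; case: (i \in S); case: (j \in S); rewrite ?andbF ?andbT.
Qed.

Lemma sum_codeg j : \sum_(i : I) codeg i j = k.-1%:R * M%:R.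
Proof.
under eq_bigr do rewrite codegC.
rewrite exchange_big /= -(sum_deg j) mulr_sumr.
by apply: eq_bigr => S /andP[SF jS]; rewrite mulr1 sum_cardD1.
Qed.

Lemma diff2_hrem_bounded i j x : `|diff j (diff i hrem) x| <= codeg i j.
Proof.
have -> : diff j (diff i hrem) x = diff j (diff i hcount) x.
  by rewrite {1}/diff !diff_hrem /diff; ring.
rewrite {1}/diff !diff_hcount.
rewrite -/(diff j (fun y => \sum_(S in F | i \in S) (S :\ i \subset y)%SET%:R) x).
rewrite diff_sum; apply: le_trans (ler_norm_sum _ _ _) _.
apply: ler_sum => S _; rewrite diff_subset normrM !normr_nat.
by rewrite ler_piMr// lern1 leq_b1.
Qed.

Lemma Ex_hlin : Ex hlin = 0.
Proof.
rewrite /hlin Ex_sum big1// => i _; rewrite ExZ ExB Ex_cst.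
rewrite (@eq_Ex _ _ _ _ (fun x => ([set i]%SET \subset x)%:R)).
  by rewrite Ex_subset cards1 expr1 subrr mulr0.
by move=> x; rewrite finset.sub1set.
Qed.

Lemma Ex_hrem : Ex hrem = 0.
Proof. by rewrite /hrem !ExB Ex_cst Ex_hlin subr0 subrr. Qed.

(** The left side is the variance of [diff i hcount], whose mean is the slope. As a double sum over
    members [S], [S'] through [i], a pair contributes nothing when the two share only [i], and at
    most 1 otherwise. Each contributing pair is charged to a common element [j]: [M] choices of [S],
    fewer than [k] of [j], at most [H] of [S']. *)
Lemma Ex_diff_hrem_sqr_le i :
  Ex (fun x => diff i hrem x ^+ 2) <= M%:R * k%:R * H%:R.
Proof.
pose A S : {set I} := (S :\ i)%SET.
have cA S : S \in F -> i \in S -> #|A S| = (k - 1)%N.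
  by move=> SF iS; have := cardF SF; rewrite (cardsD1 i) iS => <-; rewrite addnC addnK.
have EA : Ex (diff i hcount) = hslope.
  rewrite (@eq_Ex _ _ _ _ _ (diff_hcount i)) Ex_sum /hslope -(sum_deg i) mulr_sumr.
  by apply: eq_bigr => S /andP[SF iS]; rewrite Ex_subset cA// mulr1.
have E2 : Ex (fun x => diff i hcount x ^+ 2) =
    \sum_(S in F | i \in S) \sum_(S' in F | i \in S') p ^+ #|A S :|: A S'|.
  under eq_Ex do rewrite diff_hcount expr2 big_distrlr /=.
  rewrite Ex_sum; apply: eq_bigr => S _; rewrite Ex_sum; apply: eq_bigr => S' _.
  rewrite -Ex_subset; apply: eq_Ex => x.
  by rewrite -natrM mulnb finset.subUset.
have -> : Ex (fun x => diff i hrem x ^+ 2)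
    = Ex (fun x => diff i hcount x ^+ 2) - hslope ^+ 2.
  rewrite (@eq_Ex _ _ _ _ (fun x => (diff i hcount x ^+ 2
      - 2 * hslope * diff i hcount x) + hslope ^+ 2)); last first.
    by move=> x; rewrite diff_hrem; ring.
  by rewrite ExD ExB ExZ EA Ex_cst; ring.
have Mc (c : R) : \sum_(S in F | i \in S) c = M%:R * c.
  by rewrite -(sum_deg i) mulr_suml; apply: eq_bigr => S _; rewrite mul1r.
have -> : hslope ^+ 2 =
    \sum_(S in F | i \in S) \sum_(S' in F | i \in S') p ^+ (k - 1 + (k - 1)).
  by rewrite !Mc /hslope exprD; ring.
rewrite E2 -sumrB.
apply: (@le_trans _ _ (\sum_(S in F | i \in S) \sum_(j : I) (j \in A S)%:R * codeg i j)).
  apply: ler_sum => S /andP[SF iS]; rewrite -sumrB.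
  rewrite /codeg; under [leRHS]eq_bigr do rewrite mulr_sumr.
  rewrite exchange_big /=; apply: ler_sum => S' /andP[S'F iS'].
  have [AA|] := boolP [disjoint A S & A S'].
    have -> : #|A S :|: A S'|%SET = (k - 1 + (k - 1))%N.
      move: AA; rewrite -leq_card_setU => /eqP ->; by rewrite !cA.
    by rewrite subrr sumr_ge0// => j _; rewrite mulr_ge0.
  rewrite -setI_eq0 => /finset.set0Pn[j]; rewrite inE => /andP[jS jS'].
  rewrite (bigD1 j)//= jS (_ : j \in S' :\ i)%SET// mulr1.
  apply: (@le_trans _ _ 1).
    by rewrite lerBlDr (le_trans (exprn_ile1 _ p0 p1))// lerDl exprn_ge0.
  by rewrite lerDl sumr_ge0// => a _; rewrite mulr_ge0.
apply: (@le_trans _ _ (\sum_(S in F | i \in S) k%:R * H%:R)); last by rewrite Mc mulrA.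
apply: ler_sum => S /andP[SF iS].
apply: (@le_trans _ _ (\sum_(j : I) (j \in A S)%:R * H%:R)).
  by apply: ler_sum => j _; rewrite ler_wpM2l ?codeg_le.
by rewrite -mulr_suml sum_cardD1// ler_wpM2r// ler_nat leq_pred.
Qed.

(** [Ex_exp_quadratic_le] asks for the exponential moment of [q] at [mu = 4 * s ^+ 2]. Its mean part
    is [mu] times the variance sum. Its fluctuation part is [mu ^+ 2] times [#|I|] squares of the
    difference bound [2 * k * M ^+ 2], that is [64 s^4 #|I| k^2 M^4]. Halving both gives the
    constants 2 and 32. *)
Lemma Ex_exp_hrem_le (s : R) : 4 * k%:R * `|s| * M%:R <= 1 ->
  Ex (fun x => expR (s * hrem x))
    <= expR (2 * s ^+ 2 * #|I|%:R * (M%:R * k%:R * H%:R)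
             + 32 * s ^+ 4 * #|I|%:R * k%:R ^+ 2 * M%:R ^+ 4).
Proof.
move=> sM; set a := _ + _.
have k1 : 1 <= k%:R :> R by rewrite ler1n.
have M0 : 0 <= M%:R :> R by [].
have sM0 : 0 <= `|s| * M%:R by rewrite mulr_ge0.
have sM4 : `|s| * M%:R <= 4^-1.
  have := ler_wpM2r sM0 k1; rewrite mul1r => h; rewrite -!mulrA in sM; lra.
have ksM2 : 8 * k%:R * s ^+ 2 * M%:R ^+ 2 <= 2^-1.
  have -> : 8 * k%:R * s ^+ 2 * M%:R ^+ 2 = 2 * (4 * k%:R * `|s| * M%:R) * (`|s| * M%:R).
    by rewrite -[s ^+ 2]real_normK ?num_real//; ring.
  have := ler_wpM2r sM0 sM; lra.
have := @Ex_exp_quadratic_le R I p p01 hrem s a.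
rewrite Ex_hrem => h.
rewrite (@eq_Ex _ _ _ _ (fun x => expR (s * (hrem x - 0)))); last by move=> x; rewrite subr0.
apply: h => [i y|].
  rewrite !normrM (ger0_norm (ler0n _ 2)).
  have h := diff_hrem_bounded i y; have s0 := normr_ge0 s.
  have := ler_wpM2l s0 h; lra.
set q := qvar p (enum I) hrem; set mu := 4 * s ^+ 2.
have mu0 : 0 <= mu by rewrite mulr_ge0 ?sqr_ge0.
pose c (j : I) : R := 2 * k%:R * M%:R ^+ 2.
have qc j y : `|diff j q y| <= c j.
  apply: le_trans (diff_qvar_bounded p01 (enum I) y diff_hrem_bounded
    (fun i => @diff2_hrem_bounded i j)) _.
  rewrite big_enum /= sum_codeg /c.
  have -> : 2 * k%:R * M%:R ^+ 2 = 2 * M%:R * (k%:R * M%:R) :> R by ring.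
  by rewrite ler_wpM2l ?mulr_ge0// ler_wpM2r// ler_nat leq_pred.
have sumc (t : R) : \sum_(i : I) t = #|I|%:R * t by rewrite sumr_const -[LHS]mulr_natl.
have muc j : `|mu| * c j <= 2^-1.
  by rewrite ger0_norm// /mu /c; apply: le_trans ksM2; rewrite le_eqVlt;
    apply/orP; left; apply/eqP; ring.
have Eq : Ex q <= #|I|%:R * (M%:R * k%:R * H%:R).
  apply: le_trans (Ex_qvar_le p01 _ _) _.
  rewrite big_enum /= (le_trans (ler_sum _ (fun i _ => Ex_diff_hrem_sqr_le i)))//.
  by rewrite sumc.
rewrite (@eq_Ex _ _ _ _ (fun y => expR (mu * Ex q) * expR (mu * (q y - Ex q)))); last first.
  by move=> y; rewrite -expRD; congr expR; ring.
rewrite ExZ; apply: le_trans (ler_wpM2l (expR_ge0 _) (Ex_exp_bounded_le p01 qc muc)) _.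
rewrite -expRD ler_expR /c sumc.
have := ler_wpM2l mu0 Eq; rewrite /a /mu; lra.
Qed.

(** Independence makes the Laplace transform a power of one Bernoulli factor. The cubic error is
    stated with [M] instead of the smaller slope, to match the scale of the remainder estimate. *)
Lemma Ex_exp_hlin_bounds (s : R) : `|s| * M%:R <= 8^-1 ->
  expR (#|I|%:R * (s ^+ 2 * hslope ^+ 2 * (p * (1 - p)) / 2
                   - 4 * (`|s| * M%:R) ^+ 3))
    <= Ex (fun x => expR (s * hlin x))
    <= expR (#|I|%:R * (s ^+ 2 * hslope ^+ 2 * (p * (1 - p)) / 2
                        + 4 * (`|s| * M%:R) ^+ 3)).
Proof.
move=> sM; set v := s ^+ 2 * _ * _ / 2; set r := 4 * (`|s| * M%:R) ^+ 3.
have /andP[D0 DM] := hslope_ge0_le.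
set m := s * hslope.
have mM : `|m| <= `|s| * M%:R by rewrite normrM (ger0_norm D0) ler_wpM2l.
have -> : Ex (fun x => expR (s * hlin x)) =
    (p * expR (m * (1 - p)) + (1 - p) * expR (- (m * p))) ^+ #|I|.
  rewrite -prodr_const -(Ex_prod _ (fun=> expR (m * (1 - p))) (fun=> expR (- (m * p)))).
  apply: eq_Ex => x; rewrite /hlin mulr_sumr expR_sum; apply: eq_bigr => i _.
  by rewrite /m; case: (i \in x); congr expR => /=; ring.
have /andP[l u] := bernoulli_mgf_gauss p01 (le_trans mM sM).
have m3 : `|m| ^+ 3 <= (`|s| * M%:R) ^+ 3 by rewrite lerXn2r ?nnegrE ?mulr_ge0.
have vE : v = m ^+ 2 / 2 * (p * (1 - p)) by rewrite /v /m; ring.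
rewrite !expRM_natl; apply/andP; split.
  apply: lerXn2r; rewrite ?nnegrE ?expR_ge0 ?(le_trans (expR_ge0 _) l)//.
  by apply: le_trans l; rewrite ler_expR vE /r; lra.
apply: lerXn2r; rewrite ?nnegrE ?expR_ge0 ?(le_trans (expR_ge0 _) l)//.
by apply: le_trans u _; rewrite ler_expR vE /r; lra.
Qed.

End HypergraphCount.

(** * Counting cycles through one edge and through two edges *)

Section CycleCounting.
Local Open Scope nat_scope.
Implicit Types (n k m : nat).

Lemma set2_inj (T : finType) (a b u v : T) : [set a; b]%SET = [set u; v]%SET ->
  (a = u /\ b = v) \/ (a = v /\ b = u).
Proof.
move=> e.
have : a \in [set u; v]%SET by rewrite -e !inE eqxx.
have : b \in [set u; v]%SET by rewrite -e !inE eqxx orbT.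
have : u \in [set a; b]%SET by rewrite e !inE eqxx.
have : v \in [set a; b]%SET by rewrite e !inE eqxx orbT.
rewrite !inE => /orP[]/eqP-> /orP[]/eqP-> /orP[]/eqP e1 /orP[]/eqP e2; auto.
Qed.

Definition cycle_edges n k (c : {ffun 'I_k -> 'I_n}) : {set {set 'I_n}} :=
  [set [set c i; c (ordS i)] | i in 'I_k]%SET.

(** With [k] written as [m.+3], the type ['I_k] is the ring of integers modulo [k], so cyclic
    positions obey ring identities. *)
Lemma ordSE m (i : 'I_m.+3) : ordS i = (i + 1)%R.
Proof. by apply: val_inj; rewrite /= addn1. Qed.

Lemma ord_addr1_neq m (i : 'I_m.+3) : (i + 1 != i)%R.
Proof. by rewrite -[X in _ != X]addr0 (inj_eq (addrI i)). Qed.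

Lemma ord_addr2_neq m (i : 'I_m.+3) : (i + 1 + 1 != i)%R.
Proof. by rewrite -[X in _ != X]addr0 -addrA (inj_eq (addrI i)). Qed.

(** An edge met at two positions in opposite directions would force [j + 2 = j] modulo the length,
    which fails from length 3 on. *)
Lemma cycle_edge_inj n m (c : {ffun 'I_m.+3 -> 'I_n}) : injective c ->
  injective (fun i => [set c i; c (ordS i)]%SET).
Proof.
move=> cI i j /set2_inj[[/cI]//|[/cI + /cI]].
rewrite !ordSE => -> /eqP.
by rewrite (negbTE (ord_addr2_neq j)).
Qed.

Lemma cycle_step_neq n k (c : {ffun 'I_k -> 'I_n}) i : 3 <= k -> injective c ->
  c i != c (ordS i).
Proof.
case: k c i => [|[|[|m]]]// c i _ cI.
by rewrite (inj_eq cI) ordSE eq_sym ord_addr1_neq.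
Qed.

Lemma card_cycle_edges n k (c : {ffun 'I_k -> 'I_n}) : 3 <= k -> injective c ->
  #|cycle_edges c| = k.
Proof.
case: k c => [|[|[|m]]]// c _ cI.
by rewrite card_imset ?card_ord//; exact: cycle_edge_inj.
Qed.

(* Two injective walks with the same first two vertices and the same edge set
   agree: the next vertex is the other neighbour of the current one. *)
Lemma cycle_edges_inj n m (c c' : {ffun 'I_m.+3 -> 'I_n}) :
  injective c -> injective c' -> cycle_edges c = cycle_edges c' ->
  c 0%R = c' 0%R -> c 1%R = c' 1%R -> c = c'.
Proof.
move=> cI cI' ce c0 c1.
suff H i : c (i%:R)%R = c' (i%:R)%R /\ c (i.+1%:R)%R = c' (i.+1%:R)%R.
  by apply/ffunP => i; have [] := H i; rewrite natr_Zp.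
elim: i => // i [h1 h2]; split=> //.
set j : 'I_m.+3 := (i%:R)%R in h1 *.
have jS : (i.+1%:R = j + 1)%R by rewrite /j -natr1.
have jSS : (i.+2%:R = j + 1 + 1)%R by rewrite /j -!natr1.
rewrite jS in h2; rewrite jSS.
have : [set c (j + 1); c (j + 1 + 1)]%R%SET \in cycle_edges c'.
  by rewrite -ce; apply/imsetP; exists (j + 1)%R => //; rewrite ordSE.
case/imsetP => l _ /set2_inj; rewrite ordSE h2 => -[[/cI' <- //]|[/cI' /addIr <-]].
rewrite -h1 => /cI /eqP; by rewrite (negbTE (ord_addr2_neq j)).
Qed.

(** The dihedral group acts on parametrisations: the rotation [i -> j + i] is used if the cycle
    traverses the edge from [a] to [b], the reflection [i -> j + 1 - i] if it goes from [b] to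
    [a]. *)
Lemma cycle_edges_normalize n m (c : {ffun 'I_m.+3 -> 'I_n}) (a b : 'I_n) :
  injective c -> [set a; b]%SET \in cycle_edges c ->
  exists c' : {ffun 'I_m.+3 -> 'I_n}, [/\ injective c',
    cycle_edges c' = cycle_edges c, c' 0%R = a & c' 1%R = b].
Proof.
have e1 (i j : 'I_m.+3) : (j + (i - j) = i)%R by rewrite addrC subrK.
have e2 (i j : 'I_m.+3) : (j + 1 - i = j - i + 1)%R by rewrite addrAC.
have e3 (i j : 'I_m.+3) : (j + 1 - (i + 1) = j - i)%R by rewrite opprD addrACA subrr addr0.
have e4 (i j : 'I_m.+3) : (j - (j - i) = i)%R by rewrite opprB addrC subrK.
have e5 (i j : 'I_m.+3) : (j + 1 - (j - i + 1) = i)%R by rewrite e3 e4.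
have e6 (i j : 'I_m.+3) : (j + 1 - (j - i) = i + 1)%R by rewrite e2 e4.
move=> cI /imsetP[j _ /set2_inj]; rewrite ordSE => -[[-> ->]|[-> ->]].
  exists [ffun i => c (j + i)%R]; split; rewrite ?ffunE ?addr0//.
    by move=> x y; rewrite !ffunE => /cI /addrI.
  apply/setP => E; apply/imsetP/imsetP => -[i _ ->].
    by exists (j + i)%R => //; rewrite !ffunE !ordSE addrA.
  exists (i - j)%R => //; rewrite !ffunE !ordSE.
  congr [set c _; c _]%SET; first exact: esym (e1 i j).
  by rewrite addrA; congr (_ + _)%R; exact: esym (e1 i j).
exists [ffun i => c (j + 1 - i)%R]; split; rewrite ?ffunE ?subr0 ?addrK//.
  by move=> x y; rewrite !ffunE => /cI /addrI /oppr_inj.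
apply/setP => E; apply/imsetP/imsetP => -[i _ ->].
  exists (j - i)%R => //; rewrite !ffunE !ordSE finset.setUC.
  by congr [set c _; c _]%SET; [exact: e3|exact: e2].
exists (j - i)%R => //; rewrite !ffunE !ordSE finset.setUC.
by congr [set c _; c _]%SET; [exact: esym (e6 i j)|exact: esym (e5 i j)].
Qed.

(** Fixing the first two vertices removes rotations and the orientation, so a cycle through the edge
    [ab] is one tuple of remaining vertices. The default [a] of [nth] is never reached, since the
    list has length [m.+3]. *)
Definition rooted_walk n m (a b : 'I_n) (t : m.+1.-tuple 'I_n) :
    {ffun 'I_m.+3 -> 'I_n} :=
  [ffun i : 'I_m.+3 => nth a [:: a, b & t] i].

Definition rooted_paths n m (A : pred 'I_n) : {set m.-tuple 'I_n} :=
  [set t : m.-tuple 'I_n | all A t & uniq t]%SET.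

Definition avoid2 n (a b : 'I_n) : pred 'I_n := [pred x | (x != a) && (x != b)].

Lemma card_avoid2 n (a b : 'I_n) : a != b -> #|avoid2 a b| = n - 2.
Proof.
move=> ab; have := cardC (mem [set a; b]%SET); rewrite card_ord cards2 ab => h.
by rewrite -[X in X - 2]h addnC addnK; apply: eq_card => x; rewrite !inE negb_or.
Qed.

Lemma rooted_walk_inj n m (a b : 'I_n) (t : m.+1.-tuple 'I_n) : a != b ->
  t \in rooted_paths m.+1 (avoid2 a b) -> injective (rooted_walk a b t).
Proof.
rewrite inE => ab /andP[/allP tA tu] i j; rewrite !ffunE => /eqP.
have u : uniq [:: a, b & t].
  rewrite /= tu !inE (negbTE ab) /= andbT; apply/andP.
  by split; apply/negP => /tA; rewrite /avoid2 /= eqxx ?andbF.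
by rewrite nth_uniq//= ?size_tuple ?ltn_ord// => /eqP /val_inj.
Qed.

Lemma cycles_through_edge n m (a b : 'I_n) : a != b ->
  [set E | is_cycle m.+3 E & [set a; b]%SET \in E]%SET
  = [set cycle_edges (rooted_walk a b t) | t in rooted_paths m.+1 (avoid2 a b)]%SET.
Proof.
move=> ab; apply/setP => E; rewrite !inE; apply/andP/imsetP.
  case=> /existsP[c /andP[/injectiveP cI /eqP]]; rewrite -/(cycle_edges c) => -> abE.
  have [c' [cI' <- c'0 c'1]] := cycle_edges_normalize cI abE.
  pose t := [tuple c' (lift ord0 (lift ord0 i)) | i < m.+1].
  have tE : rooted_walk a b t = c'.
    apply/ffunP => i; rewrite ffunE; case: (unliftP ord0 i) => [j|] -> //=.
    case: (unliftP ord0 j) => [l|] -> /=.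
      by rewrite -(tnth_nth a t l) tnth_mktuple.
    by rewrite -c'1; congr (c' _); apply: val_inj.
  exists t; last by rewrite tE.
  rewrite inE; apply/andP; split.
    apply/allP => x /mapP[i _ ->]; rewrite /avoid2 /= -c'0 -c'1 !(inj_eq cI').
    by [].
  by rewrite map_inj_uniq ?enum_uniq// => i j /cI' /lift_inj /lift_inj.
case=> t tT ->; split.
  apply/existsP; exists (rooted_walk a b t); rewrite eqxx andbT.
  by apply/injectiveP; exact: rooted_walk_inj.
by apply/imsetP; exists ord0 => //; rewrite !ffunE.
Qed.

Lemma rooted_walk_edges_inj n m (a b : 'I_n) : a != b ->
  {in rooted_paths m.+1 (avoid2 a b) &,
    injective (fun t => cycle_edges (rooted_walk a b t))}.
Proof.
move=> ab t t' tT tT' /cycle_edges_inj h.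
have /ffunP {}h : rooted_walk a b t = rooted_walk a b t'.
  by apply: h; [exact: rooted_walk_inj|exact: rooted_walk_inj|rewrite !ffunE..].
apply: eq_from_tnth => i; have := h (lift ord0 (lift ord0 i)).
by rewrite !ffunE /= !(tnth_nth a).
Qed.

Lemma card_cycles_through_edge n k (a b : 'I_n) : 3 <= k -> a != b ->
  #|[set E | is_cycle k E & [set a; b]%SET \in E]%SET| = (n - 2) ^_ (k - 2).
Proof.
case: k => [|[|[|m]]]// _ ab.
rewrite cycles_through_edge// card_in_imset; last exact: rooted_walk_edges_inj.
by rewrite card_uniq_tuples card_avoid2.
Qed.

(** The second edge has an end [d] outside the first, and a cycle containing both passes through
    [d]. The bound is therefore the number of rooted tuples minus the number of those avoiding [d],
    that is [(n-2)^_(m+1) - (n-3)^_(m+1)], at most [(m+1) (n-3)^_m]. *)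
Lemma card_cycles_through_edges n k (a b : 'I_n) (G : {set 'I_n}) : 3 <= k ->
  a != b -> #|G| = 2 -> G != [set a; b]%SET ->
  #|[set E | is_cycle k E && ([set a; b]%SET \in E) && (G \in E)]%SET|
    <= (k - 2) * (n - 3) ^_ (k - 3).
Proof.
case: k => [|[|[|m]]]// _ ab G2 Gab.
have [d dG dab] : exists2 d, d \in G & d \in avoid2 a b.
  have /fintype.subsetPn[d dG dab] : ~~ (G \subset [set a; b]%SET).
    apply: contra Gab => GS; rewrite eqEcard GS cards2 ab G2 //.
  by exists d => //; move: dab; rewrite !inE negb_or.
set T := rooted_paths m.+1 (avoid2 a b).
set T' := rooted_paths m.+1 [pred x | avoid2 a b x && (x != d)].
have TT' : T' \subset T.
  apply/fintype.subsetP => t; rewrite !inE => /andP[/allP h ->]; rewrite andbT.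
  by apply/allP => x /h /andP[].
have cT' : #|T'| = (n - 3) ^_ m.+1.
  rewrite card_uniq_tuples; congr (_ ^_ _).
  have := card_avoid2 ab; rewrite (cardD1 d) dab => h.
  have -> : n - 3 = n - 2 - 1 by rewrite -subnDA.
  by rewrite -h add1n subn1 /=; apply: eq_card => x; rewrite !inE andbC.
have n3 : n - 2 = (n - 3).+1.
  have -> : n - 3 = n - 2 - 1 by rewrite -subnDA.
  by have := card_avoid2 ab; rewrite (cardD1 d) dab => <-; rewrite add1n subn1.
apply: (@leq_trans #|T :\: T'|%SET).
  apply: leq_trans (leq_imset_card (fun t => cycle_edges (rooted_walk a b t)) _).
  apply/subset_leq_card/fintype.subsetP => E; rewrite inE => /andP[Eab GE].
  have : E \in [set E | is_cycle m.+3 E & [set a; b]%SET \in E]%SET by rewrite inE.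
  rewrite cycles_through_edge// => /imsetP[t tT tE]; apply/imsetP; exists t => //.
  rewrite !inE; move: (tT); rewrite inE => /andP[tA ->]; rewrite tA !andbT.
  have dt : d \in val t.
    have : d \in [:: a, b & val t].
      have M j : rooted_walk a b t j \in [:: a, b & val t].
        by rewrite ffunE mem_nth//= size_tuple.
      move: GE; rewrite tE => /imsetP[i _ Gi]; move: dG.
      by rewrite Gi finset.in_set2 => /orP[]/eqP ->; exact: M.
    by move: dab; rewrite !inE => /andP[/negbTE -> /negbTE ->].
  by apply/negP => /allP /(_ d dt) /andP[_]; rewrite eqxx.
rewrite cardsD (finset.setIidPr TT') cT' card_uniq_tuples card_avoid2// n3.
rewrite ffactSS ffactnSr [X in _ - X]mulnC -mulnBl !subSS !subn0.
by apply: leq_mul => //; lia.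
Qed.

End CycleCounting.

(** * Cycles as a hypergraph on the edges of the complete graph *)

Section EdgeIndex.
Variables (n k : nat).
Hypothesis k_ge3 : (3 <= k)%N.

Definition edge_pairs : {set 'I_n * 'I_n} :=
  [set ij : 'I_n * 'I_n | (ij.1 < ij.2)%N]%SET.
Definition edge := {ij | ij \in edge_pairs}.
Definition edge_ends (e : edge) : {set 'I_n} := [set (val e).1; (val e).2]%SET.
Definition cycle_family : {set {set edge}} :=
  [set S : {set edge} | is_cycle k (edge_ends @: S)%SET]%SET.

Lemma edge_lt (e : edge) : ((val e).1 < (val e).2)%N.
Proof. by have := valP e; rewrite inE. Qed.

Lemma edge_neq (e : edge) : (val e).1 != (val e).2.
Proof. by rewrite -val_eqE /= ltn_eqF// edge_lt. Qed.

Lemma edge_ends_inj : injective edge_ends.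
Proof.
move=> e f /set2_inj[[e1 e2]|[e1 e2]].
  by apply: val_inj; rewrite [LHS]surjective_pairing e1 e2 -surjective_pairing.
by have := edge_lt e; rewrite e1 e2 ltnNge (ltnW (edge_lt f)).
Qed.

Lemma card_edge_ends (e : edge) : #|edge_ends e| = 2%N.
Proof. by rewrite cards2 edge_neq. Qed.

Lemma edge_endsP (a b : 'I_n) : a != b ->
  exists e : edge, edge_ends e = [set a; b]%SET.
Proof.
have H (i j : 'I_n) : (i < j)%N -> exists e : edge, edge_ends e = [set i; j]%SET.
  move=> ij; have ijP : (i, j) \in edge_pairs by rewrite inE.
  by exists (Sub (i, j) ijP).
rewrite -val_eqE neq_ltn => /orP[/H //|/H[e eE]].
by exists e; rewrite eE finset.setUC.
Qed.

Lemma card_edge : #|{: edge}| = 'C(n, 2).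
Proof.
rewrite -[X in 'C(X, _)](card_ord n) -card_draws -(card_imset _ edge_ends_inj).
apply: eq_card => A; rewrite inE; apply/imsetP/idP => [[e _ ->]|].
  by rewrite card_edge_ends.
by move=> /cards2P[a [b [ab ->]]]; have [e eE] := edge_endsP ab; exists e.
Qed.

Lemma cycle_family_card (S : {set edge}) : S \in cycle_family -> #|S| = k.
Proof.
rewrite inE => /existsP[c /andP[/injectiveP cI /eqP Sc]].
by rewrite -(card_imset _ edge_ends_inj) Sc; exact: card_cycle_edges.
Qed.

Lemma is_cycle_imset (E : {set {set 'I_n}}) : is_cycle k E ->
  E = (edge_ends @: (edge_ends @^-1: E))%SET.
Proof.
move=> /existsP[c /andP[/injectiveP cI /eqP EE]].
apply/setP => G; apply/idP/imsetP => [GE|[e]]; last by rewrite inE => ? ->.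
move: (GE); rewrite {1}EE => /imsetP[i _ Gi].
have [e eE] := edge_endsP (cycle_step_neq i k_ge3 cI).
by exists e; rewrite ?inE eE -Gi.
Qed.

(** Taking images under [edge_ends] is injective on sets of indices and reaches every cycle, because
    consecutive vertices of a cycle are distinct; the counts above thus transfer to index sets. *)
Lemma card_cycle_family (Q : pred {set {set 'I_n}}) :
  #|[set S in cycle_family | Q (edge_ends @: S)%SET]%SET|
  = #|[set E | is_cycle k E && Q E]%SET|.
Proof.
rewrite -(card_imset _ (imset_inj edge_ends_inj)); apply: eq_card => E.
apply/imsetP/idP => [[S]|]; first by rewrite !inE => ? ->.
rewrite inE => /andP[cE QE]; have ES := is_cycle_imset cE.
by exists (edge_ends @^-1: E)%SET => //; rewrite !inE -ES cE.
Qed.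

Lemma cycle_family_deg (e : edge) :
  #|[set S in cycle_family | e \in S]%SET| = ((n - 2) ^_ (k - 2))%N.
Proof.
rewrite -(card_cycles_through_edge k_ge3 (edge_neq e)).
rewrite -(card_cycle_family (fun E => edge_ends e \in E)).
by apply: eq_card => S; rewrite !inE (mem_imset _ _ edge_ends_inj).
Qed.

Lemma cycle_family_codeg (e f : edge) : e != f ->
  (#|[set S in cycle_family | (e \in S) && (f \in S)]%SET|
    <= (k - 2) * (n - 3) ^_ (k - 3))%N.
Proof.
move=> ef; have fe : edge_ends f != edge_ends e.
  by rewrite (inj_eq edge_ends_inj) eq_sym.
apply: leq_trans (card_cycles_through_edges k_ge3 (edge_neq e) (card_edge_ends f) fe).
apply: (@leq_trans #|[set S in cycle_family | [pred E : {set {set 'I_n}} |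
  (edge_ends e \in E) && (edge_ends f \in E)] (edge_ends @: S)%SET]%SET|).
  by apply: subset_leq_card; apply/fintype.subsetP => S;
    rewrite !inE /= !(mem_imset _ _ edge_ends_inj).
rewrite card_cycle_family; apply: subset_leq_card; apply/fintype.subsetP => E.
by rewrite !inE /= andbA.
Qed.

Lemma cycle_countE (R : realFieldType) (A : 'M[R]_n) :
  cycle_count k A =
  #|[set S in cycle_family | S \subset [set e | A (val e).1 (val e).2 == 1]]%SET|.
Proof.
set x := [set e : edge | A _ _ == 1]%SET.
have gE : graph_edges A = (edge_ends @: x)%SET.
  apply/setP => G; apply/imset2P/imsetP => [[i j _]|[e]].
    rewrite inE => /andP[_ /andP[ij Aij]] ->.
    have ijP : (i, j) \in edge_pairs by rewrite inE.
    by exists (Sub (i, j) ijP); rewrite ?inE.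
  rewrite inE => Ae ->; exists (val e).1 (val e).2; rewrite ?inE//.
  by rewrite edge_lt Ae.
rewrite /cycle_count gE -(card_cycle_family (fun E => E \subset edge_ends @: x)%SET).
apply: eq_card => S; rewrite !inE; congr andb.
apply/idP/idP => [|/imsetS ->//] /fintype.subsetP Sx; apply/fintype.subsetP => e eS.
have := Sx _ (imset_f edge_ends eS).
by rewrite (mem_imset _ _ edge_ends_inj).
Qed.

End EdgeIndex.

(** * Passing from the probability space to the law of the edge configuration *)

Section FiniteObservable.
Variables (R : realType) (d : measure_display) (Omega : measurableType d).
Variables (P : probability Omega R) (C : finType) (conf : Omega -> C) (w : C -> R).
Hypothesis mfiber : forall x, measurable (conf @^-1` [set x]).
Hypothesis Pfiber : forall x, P (conf @^-1` [set x]) = (w x)%:E.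

Lemma measurable_conf (Q : set C) : measurable (conf @^-1` Q).
Proof.
have -> : conf @^-1` Q = \big[setU/set0]_(x <- enum C | x \in Q) (conf @^-1` [set x]).
  apply/seteqP; split=> [z /= Qz|z].
    rewrite -bigcup_seq_cond; exists (conf z) => //=.
    by rewrite mem_enum mem_set.
  by rewrite -bigcup_seq_cond => -[x /= /andP[_ /set_mem Qx]] ->.
by apply: bigsetU_measurable.
Qed.

Lemma measurable_fun_conf (f : C -> R) : measurable_fun [set: Omega] (f \o conf).
Proof. by move=> _ B mB; rewrite setTI comp_preimage; exact: measurable_conf. Qed.

(** A function of the configuration is a finite combination of indicators of fibres; nonnegativity
    of [f] allows the integral to be taken termwise. *)
Lemma expectation_conf (f : C -> R) : (forall x, 0 <= f x) ->
  ('E_P[f \o conf] = (\sum_x w x * f x)%:E)%E.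
Proof.
move=> f0; rewrite unlock.
have fE o : ((f \o conf) o)%:E =
    (\sum_(x <- enum C) ((f x)%:E * (\1_(conf @^-1` [set x]) o)%:E)%E)%E.
  rewrite big_enum /= (bigD1 (conf o))//= big1 ?adde0; last first.
    by move=> x xo; rewrite indicE memNset ?mule0//= => oE; rewrite oE eqxx in xo.
  by rewrite indicE mem_set// mule1.
under eq_integral do rewrite fE.
rewrite ge0_integral_sum//=; first last.
- by move=> x o _; rewrite -EFinM lee_fin mulr_ge0.
- by move=> x; apply: measurable_funeM; apply/measurable_EFinP; exact: measurable_indic.
rewrite big_enum /= -sumEFin; apply: eq_bigr => x _.
rewrite ge0_integralZl_EFin//=; last first.
  by apply/measurable_EFinP; exact: measurable_indic.
rewrite integral_indic//; rewrite setIT.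
by rewrite EFinM muleC; congr (_ * _)%E; exact: Pfiber.
Qed.

Lemma probability_conf (Q : set C) :
  P (conf @^-1` Q) = (\sum_x w x * (x \in Q)%:R)%:E.
Proof.
rewrite -(expectation_indic P (measurable_conf Q)).
have -> : \1_(conf @^-1` Q) = (fun x => (x \in Q)%:R) \o conf :> (Omega -> R).
  by apply/funext => o; rewrite indicE.
by rewrite expectation_conf.
Qed.

End FiniteObservable.

Section EdgeConfiguration.
Variables (R : realType) (d : measure_display) (Omega : measurableType d).
Variables (P : probability Omega R) (n : nat) (p : R).
Variable X : 'M[{RV P >-> R}]_n.
Hypothesis Xindep : mutually_independent P (edge_pairs n)
  (fun ij w => X ij.1 ij.2 w).
Hypothesis Xbernoulli1 : forall i j : 'I_n, (i < j)%N ->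
  P (X i j @^-1` [set 1]) = p%:E.

Definition edge_conf (w : Omega) : {set edge n} :=
  [set e : edge n | X (val e).1 (val e).2 w == 1]%SET.

(** An absent edge is recorded by the complement of [[set 1]], not by [[set 0]]: the fibres of
    [edge_conf] are then these boxes exactly, not only up to a null set. *)
Let box (x : {set edge n}) (ij : 'I_n * 'I_n) : set R :=
  if ij \in (val @: x)%SET then [set 1] else ~` [set 1].

Let measurable_box x ij : measurable (box x ij).
Proof. by rewrite /box; case: ifP => _; [|apply: measurableC]; exact: measurable_set1. Qed.

Let fiberE x : edge_conf @^-1` [set x] =
  \bigcap_(ij in [set` edge_pairs n]) (fun w => X ij.1 ij.2 w) @^-1` box x ij.
Proof.
apply/seteqP; split=> w /=.
  move=> <- ij /= ijE; pose e : edge n := Sub ij ijE.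
  rewrite /box (_ : ij = val e)// (mem_imset _ _ val_inj) inE.
  by case: eqP.
move=> wx; apply/setP => e; rewrite inE.
have := wx (val e) (valP e); rewrite /= /box (mem_imset _ _ val_inj).
by case: (e \in x) => /= [->|/eqP/negbTE //]; rewrite eqxx.
Qed.

Lemma measurable_edge_conf x : measurable (edge_conf @^-1` [set x]).
Proof.
rewrite fiberE; apply: fin_bigcap_measurable; first exact: finite_finset.
move=> ij _; have h := @measurable_funPTI _ _ _ _ (X ij.1 ij.2). exact: h (measurable_box x ij).
Qed.

Lemma probability_edge_conf x : P (edge_conf @^-1` [set x]) = (weight p x)%:E.
Proof.
rewrite fiberE (Xindep (subxx _) (measurable_box x)).
rewrite big_sub /weight -prodEFin; apply: eq_bigr => e _.
rewrite /box (mem_imset _ _ val_inj); case: ifP => _.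
  exact/Xbernoulli1/edge_lt.
rewrite -preimage_setC probability_setC; last first.
  by have h := @measurable_funPTI _ _ _ _ (X (val e).1 (val e).2); exact: h (measurable_set1 1).
by rewrite Xbernoulli1// edge_lt.
Qed.

End EdgeConfiguration.

(** * The large deviation principle from two-sided tail and ball estimates *)

Section GaussianLDP.
Variable R : realType.

Lemma limn_esup_le (u : (\bar R)^nat) (l : \bar R) :
  (\forall n \near \oo, (u n <= l)%E) -> (limn_esup u <= l)%E.
Proof.
move=> ul; apply: (@le_trans _ _ (ereal_sup (u @` [set n | (u n <= l)%E]))).
  by apply: ereal_inf_lbound; exists [set n | (u n <= l)%E].
by apply: ge_ereal_sup => _ [n /= un <-].
Qed.

Lemma limn_einf_ge (u : (\bar R)^nat) (l : \bar R) :
  (\forall n \near \oo, (l <= u n)%E) -> (l <= limn_einf u)%E.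
Proof.
move=> lu; rewrite /limn_einf leeNr; apply: limn_esup_le.
by apply: filterS lu => n; rewrite leeN2.
Qed.

Lemma lne_le_expR (x : \bar R) (r : R) :
  (x <= (expR r)%:E)%E -> (lne x <= r%:E)%E.
Proof.
case: x => [x| |]//=; last by rewrite !leNye.
rewrite lee_fin; case: ifPn => [_ _|]; first by rewrite leNye.
rewrite -ltNge => x0 xr; rewrite lee_fin -[r]expRK; by rewrite ler_ln ?posrE ?expR_gt0.
Qed.

Lemma expR_le_lne (x : \bar R) (r : R) :
  ((expR r)%:E <= x)%E -> (r%:E <= lne x)%E.
Proof.
case: x => [x| |]//; last by rewrite !leey.
rewrite lee_fin => rx; have x0 := lt_le_trans (expR_gt0 r) rx.
by rewrite lne_EFin// lee_fin -[r]expRK ler_ln ?posrE ?expR_gt0.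
Qed.

Lemma good_rate_function_gaussian (K : R) : 0 < K ->
  good_rate_function (fun x : R => (x ^+ 2 / (2 * K))%:E).
Proof.
move=> K0; have K2 : 0 < 2 * K by rewrite mulr_gt0.
split=> [x|a a0]; first by rewrite lee_fin divr_ge0 ?sqr_ge0// ltW.
have -> : [set x | ((x ^+ 2 / (2 * K))%:E <= a%:E)%E]
    = `[- Num.sqrt (a * (2 * K)), Num.sqrt (a * (2 * K))]%classic.
  apply/seteqP; split=> x /=; rewrite lee_fin ler_pdivrMr// in_itv/= -ler_norml.
    by move=> h; rewrite -sqrtr_sqr ler_wsqrtr.
  have {2}<- : Num.sqrt (a * (2 * K)) ^+ 2 = a * (2 * K).
    by rewrite sqr_sqrtr// mulr_ge0// ltW.
  move=> h; rewrite -[x ^+ 2]real_normK ?num_real//.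
  by rewrite lerXn2r ?nnegrE ?sqrtr_ge0.
exact: segment_compact.
Qed.

(** The rate increases with [|x|], so a set on which its infimum is [j] lies in [|y| >= m] with
    [m ^+ 2 / (2 * K) = j]; one two-sided tail replaces the usual covering argument for closed sets.
    Lower bounds on balls around interior points give the other half. *)
Lemma LDP_gaussian (d : nat -> measure_display)
  (Omega : forall n, measurableType (d n))
  (P : forall n, probability (Omega n) R) (T : forall n, Omega n -> R)
  (s : nat -> R) (K : R) : 0 < K ->
  (forall n, measurable_fun [set: Omega n] (T n)) ->
  s @ \oo --> +oo%R ->
  (forall m eta : R, 0 <= m -> 0 < eta -> \forall n \near \oo,
     forall B : set R, measurable B -> (forall y, B y -> m <= `|y|) ->
     (P n (T n @^-1` B) <= (expR (- (s n * (m ^+ 2 / (2 * K) - eta))))%:E)%E) ->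
  (forall x delta eta : R, 0 < delta -> 0 < eta -> \forall n \near \oo,
     forall B : set R, measurable B -> (forall y, `|y - x| < delta -> B y) ->
     ((expR (- (s n * (x ^+ 2 / (2 * K) + eta))))%:E <= P n (T n @^-1` B))%E) ->
  LDP P T s (fun x => (x ^+ 2 / (2 * K))%:E).
Proof.
move=> K0 mT soo HU HL; have K2 : 0 < 2 * K by rewrite mulr_gt0.
have s0 : \forall n \near \oo, 0 < s n by move/cvgryPgt : soo => /(_ 0).
split=> //; first exact: good_rate_function_gaussian.
move=> G mG a; split.
  rewrite leeNl; apply: le_ereal_inf_tmp => _ [x Gx <-].
  rewrite leeNl; apply/lee_subgt0Pr => e e0.
  move: Gx; rewrite /interior /= => /nbhs_ballP[r /= r0 rG].
  apply: limn_einf_ge; apply: filterS2 s0 (HL x r e r0 e0) => n sn.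
  have rG' y : `|y - x| < r -> G y by move=> yx; apply: rG; rewrite /ball/= distrC.
  move=> /(_ G mG rG') /expR_le_lne h.
  apply: le_trans (lee_wpmul2l _ h); last by rewrite lee_fin invr_ge0 ltW.
  by rewrite -EFinM -EFinD lee_fin mulrN mulKf ?gt_eqF// opprD.
(* An empty set has infimum [+oo], matched by [lne 0 = -oo]; a point of [G] makes the infimum
   finite. *)
have [G0|/set0P[g Gg]] := eqVneq G set0.
  apply: limn_esup_le; apply: filterS s0 => n sn.
  rewrite /a G0 preimage_set0 measure0 le0_lneNy//.
  by rewrite gt0_muleNy ?leNye// lte_fin invr_gt0.
set J := ereal_inf _.
have J0 : (0 <= J)%E.
  apply: le_ereal_inf_tmp => _ [y _ <-].
  by rewrite lee_fin divr_ge0 ?sqr_ge0// ltW.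
have Jfin : J \is a fin_num.
  rewrite ge0_fin_numE//; apply: (@le_lt_trans _ _ (g ^+ 2 / (2 * K))%:E); last by rewrite ltry.
  by apply: ereal_inf_lbound; exists g => //; exact: subset_closure.
set j := fine J; have jJ : J = j%:E by rewrite fineK.
have j0 : 0 <= j by rewrite -lee_fin -jJ.
pose m := Num.sqrt (j * (2 * K)).
have mE : m ^+ 2 / (2 * K) = j by rewrite /m sqr_sqrtr ?mulfK ?gt_eqF// mulr_ge0// ltW.
have Gm y : G y -> m <= `|y|.
  move=> Gy; rewrite -sqrtr_sqr ler_wsqrtr// -ler_pdivlMr// -lee_fin -jJ.
  by apply: ereal_inf_lbound; exists y => //; exact: subset_closure.
rewrite jJ; apply/lee_addgt0Pr => e e0.
apply: limn_esup_le; apply: filterS2 s0 (HU m e (sqrtr_ge0 _) e0) => n sn.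
move=> /(_ G mG Gm) /lne_le_expR h.
apply: le_trans (lee_wpmul2l _ h) _; first by rewrite lee_fin invr_ge0 ltW.
by rewrite -EFinM -EFinD lee_fin mulrN mulKf ?gt_eqF// mE opprB addrC.
Qed.

End GaussianLDP.

(** * Tails of a sum [Y + Z] from Laplace asymptotics *)

Section LaplaceTails.
Variables (R : realType) (I : nat -> finType) (p : nat -> R).
Hypothesis p01 : forall n, 0 <= p n <= 1.
Variables (Y Z : forall n, {set I n} -> R) (s : nat -> R) (K : R).
Arguments Y : clear implicits.
Arguments Z : clear implicits.
Hypothesis K_gt0 : 0 < K.
Hypothesis s_oo : s @ \oo --> +oo.
Hypothesis laplaceY : forall t eta : R, 0 < eta -> \forall n \near \oo,
  expR (s n * (t ^+ 2 * K / 2 - eta)) <= Ex (p n) (fun x => expR (t * s n * Y n x))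
    <= expR (s n * (t ^+ 2 * K / 2 + eta)).
Hypothesis laplaceZ : forall t eta : R, 0 < eta -> \forall n \near \oo,
  Ex (p n) (fun x => expR (t * s n * Z n x)) <= expR (s n * eta).

Local Notation pr n A := (Ex (p n) (fun x => (A x : bool)%:R)).

Lemma speed_gt0 : \forall n \near \oo, 0 < s n.
Proof. by move/cvgryPgt : s_oo => /(_ 0). Qed.

Lemma speed_exp_ge (c C : R) : 0 < c -> \forall n \near \oo, C <= expR (s n * c).
Proof.
move=> c0; move/cvgryPge : s_oo => /(_ (C / c)); apply: filterS => n.
rewrite ler_pdivrMr// => h; apply: le_trans h _.
by have := expR_ge1Dx (s n * c); lra.
Qed.

(** Since the Laplace transform of [Z] is subexponential at every [t], Chernoff works with [t] as
    large as desired: [t * e = |M| + 1] pays for the rate [M] and for the error [eta = 1]. *)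
Lemma tail_negligible (e M : R) : 0 < e -> \forall n \near \oo,
  pr n (fun x => e <= `|Z n x|) <= 2 * expR (- (s n * M)).
Proof.
move=> e0; pose t := (`|M| + 1) / e.
have t0 : 0 < t by rewrite divr_gt0// ltr_wpDl.
apply: filterS3 speed_gt0 (laplaceZ t ltr01) (laplaceZ (- t) ltr01) => n s0 h1 h2.
apply: (@le_trans _ _ (Ex (p n) (fun x => expR (- (t * s n * e)) *
    (expR (t * s n * Z n x) + expR (- t * s n * Z n x))))).
  apply: le_Ex => // x; rewrite mulrDr -!expRD.
  case: (leP e `|Z n x|) => [|_]; last by rewrite addr_ge0 ?expR_ge0.
  have ts0 : 0 <= t * s n by rewrite mulr_ge0 ?ltW.
  rewrite ler_normr => /orP[] h.
    apply: (@le_trans _ _ (expR (- (t * s n * e) + t * s n * Z n x))); last first.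
      by rewrite lerDl expR_ge0.
    by rewrite -[leLHS]expR0 ler_expR; have := ler_wpM2l ts0 h; lra.
  apply: (@le_trans _ _ (expR (- (t * s n * e) + - t * s n * Z n x))); last first.
    by rewrite lerDr expR_ge0.
  by rewrite -[leLHS]expR0 ler_expR; have := ler_wpM2l ts0 h; lra.
rewrite ExZ ExD.
have E : expR (- (s n * (`|M| + 1))) * expR (s n * 1) <= expR (- (s n * M)).
  by rewrite -expRD ler_expR; have := ler_wpM2l (ltW s0) (ler_norm M); lra.
have -> : t * s n * e = s n * (`|M| + 1) by rewrite /t; field; rewrite gt_eqF.
have h3 := lerD h1 h2.
apply: le_trans (ler_wpM2l (expR_ge0 _) h3) _; lra.
Qed.

Lemma tail_upper (m eta : R) : 0 <= m -> 0 < eta -> \forall n \near \oo,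
  pr n (fun x => m <= `|Y n x + Z n x|) <= expR (- (s n * (m ^+ 2 / (2 * K) - eta))).
Proof.
(* This [t] optimises the Chernoff exponent [t m - t^2 K / 2]. The loss [eta] is spent in thirds: on
   the shift [t * e] made for [Z], on the Laplace error, and on the factor 4 from adding the terms.
   The [m + 1] in [e] covers [m = 0]. *)
move=> m0 eta0; pose t := m / K.
have m1 : 0 < m + 1 by rewrite ltr_wpDl.
pose e := eta * K / (3 * (m + 1)).
have e0 : 0 < e by rewrite divr_gt0// mulr_gt0.
have te : t * e <= eta / 3.
  rewrite /t /e (_ : _ * _ = eta / 3 * (m / (m + 1))); last by field; rewrite !gt_eqF.
  by rewrite ler_piMr ?divr_ge0 ?(ltW eta0)// ler_pdivrMr// mul1r; lra.
have t0 : 0 <= t by rewrite divr_ge0// ltW.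
have eta3 : 0 < eta / 3 by rewrite divr_gt0.
have HY1 := laplaceY t eta3; have HY2 := laplaceY (- t) eta3.
near=> n.
have s0 : 0 < s n by near: n; exact: speed_gt0.
have hZ : pr n (fun x => e <= `|Z n x|) <= 2 * expR (- (s n * (m ^+ 2 / (2 * K)))).
  by near: n; exact: tail_negligible.
have /andP[_ h1] : expR (s n * (t ^+ 2 * K / 2 - eta / 3)) <=
  Ex (p n) (fun x => expR (t * s n * Y n x)) <= expR (s n * (t ^+ 2 * K / 2 + eta / 3)).
  by near: n.
have /andP[_ h2] : expR (s n * ((- t) ^+ 2 * K / 2 - eta / 3)) <=
  Ex (p n) (fun x => expR (- t * s n * Y n x)) <= expR (s n * ((- t) ^+ 2 * K / 2 + eta / 3)).
  by near: n.
have h4 : 4 <= expR (s n * (eta / 3)) by near: n; exact: speed_exp_ge.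
have ts0 : 0 <= t * s n by rewrite mulr_ge0// ltW.
have h : pr n (fun x => m <= `|Y n x + Z n x|) <=
    Ex (p n) (fun x => expR (- (t * s n * (m - e))) *
    (expR (t * s n * Y n x) + expR (- t * s n * Y n x)) + (e <= `|Z n x|)%R%:R).
  apply: le_Ex => // x; rewrite mulrDr -!expRD.
  set A := expR _; set B := expR _.
  have [A0 B0] : 0 <= A /\ 0 <= B by rewrite !expR_ge0.
  case: (leP e `|Z n x|) => [_|Ze].
    by rewrite ler_wpDl ?addr_ge0// lern1 leq_b1.
  case: (leP m `|Y n x + Z n x|) => [|_]; last by rewrite !addr_ge0.
  move=> h; have {h} : m - e <= `|Y n x| by have := ler_normD (Y n x) (Z n x); lra.
  rewrite ler_normr addr0 => /orP[] h.
    apply: (@le_trans _ _ A); last by rewrite lerDl.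
    by rewrite -[leLHS]expR0 ler_expR; have := ler_wpM2l ts0 h; lra.
  apply: (@le_trans _ _ B); last by rewrite lerDr.
  by rewrite -[leLHS]expR0 ler_expR; have := ler_wpM2l ts0 h; lra.
apply: le_trans h _; rewrite ExD ExZ ExD; rewrite sqrrN in h2.
set E := expR (- (s n * (m ^+ 2 / (2 * K) - 2 * eta / 3))).
have E1 : expR (- (t * s n * (m - e))) * expR (s n * (t ^+ 2 * K / 2 + eta / 3)) <= E.
  rewrite -expRD ler_expR.
  have -> : - (t * s n * (m - e)) + s n * (t ^+ 2 * K / 2 + eta / 3)
     = - (s n * (m ^+ 2 / (2 * K) - t * e - eta / 3)).
    by rewrite /t; field; rewrite gt_eqF.
  by rewrite lerN2 ler_pM2l//; lra.
have E2 : expR (- (s n * (m ^+ 2 / (2 * K)))) <= E.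
  by rewrite ler_expR lerN2 ler_pM2l//; lra.
have E3 : 4 * E <= expR (- (s n * (m ^+ 2 / (2 * K) - eta))).
  have -> : - (s n * (m ^+ 2 / (2 * K) - eta)) =
     s n * (eta / 3) + - (s n * (m ^+ 2 / (2 * K) - 2 * eta / 3)) by field; rewrite gt_eqF.
  by rewrite expRD ler_wpM2r ?expR_ge0.
have h3 := ler_wpM2l (expR_ge0 (- (t * s n * (m - e)))) (lerD h1 h2).
by move: h3 E1 E2 E3 hZ; rewrite mulrDr; lra.
Unshelve. all: by end_near. Qed.

Lemma tail_lower (x0 delta eta : R) : 0 < delta -> 0 < eta -> \forall n \near \oo,
  expR (- (s n * (x0 ^+ 2 / (2 * K) + eta)))
    <= pr n (fun x => `|Y n x + Z n x - x0| < delta).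
Proof.
move=> delta0 eta0; pose t := x0 / K.
have x1 : 0 < `|x0| + 1 by rewrite ltr_wpDl.
(* [Y] is confined to a window of radius [r] around [x0]: [delta / 2] leaves room for [Z], and the
   other two bounds make [|t| * r] and [e'] at most [eta / 4]. Under the tilt, leaving the window
   has rate [r^2 / (2 K) = 4 e'], attained at the extra slope [u = r / K]; two Laplace errors use
   [2 e'], and [2 e'] remains to beat constants. *)
pose r := Num.min (Num.min (delta / 2) 1) (eta * K / (4 * (`|x0| + 1))).
have r0 : 0 < r.
  by rewrite /r !lt_min divr_gt0//= ltr01/= divr_gt0// mulr_gt0.
have r_delta : r <= delta / 2 by rewrite /r !ge_min lexx.
have r1 : r <= 1 by rewrite /r !ge_min lexx orbT.
have r2 : r <= eta * K / (4 * (`|x0| + 1)) by rewrite /r !ge_min lexx !orbT.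
have r3 : r * (4 * (`|x0| + 1)) <= eta * K by rewrite -ler_pdivlMr// mulr_gt0.
have tr : `|t| * r <= eta / 4.
  rewrite /t normrM normfV (gtr0_norm K_gt0) mulrAC ler_pdivrMr//.
  by have := normr_ge0 x0; lra.
pose u := r / K.
pose e' := r ^+ 2 / (8 * K).
have e'0 : 0 < e' by rewrite divr_gt0 ?exprn_gt0// mulr_gt0.
have e'4 : e' <= eta / 4.
  rewrite /e' ler_pdivrMr ?mulr_gt0//.
  have : r ^+ 2 <= r by rewrite expr2 ler_piMr// ltW.
  have := mulr_ge0 (normr_ge0 x0) (ltW r0); have := mulr_gt0 eta0 K_gt0; lra.
have gap : 0 <= eta / 2 - `|t| * r - e' by lra.
clear r1 r2 r3 e'4 tr.
have HY0 := laplaceY t e'0.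
have HY1 := laplaceY (t + u) e'0; have HY2 := laplaceY (t - u) e'0.
(* All but the final 1 is the decay rate of the lower bound [q] obtained below; the extra 1 makes
   the contribution of [Z] at most a quarter of [q]. *)
pose M := x0 ^+ 2 / (2 * K) + `|t| * r + e' + 1.
near=> n.
have s0 : 0 < s n by near: n; exact: speed_gt0.
have hZ : pr n (fun x => delta / 2 <= `|Z n x|) <= 2 * expR (- (s n * M)).
  by near: n; apply: tail_negligible; rewrite divr_gt0.
have /andP[h0 _] : expR (s n * (t ^+ 2 * K / 2 - e')) <=
  Ex (p n) (fun x => expR (t * s n * Y n x)) <= expR (s n * (t ^+ 2 * K / 2 + e')).
  by near: n.
have /andP[_ h1] : expR (s n * ((t + u) ^+ 2 * K / 2 - e')) <=
  Ex (p n) (fun x => expR ((t + u) * s n * Y n x)) <= expR (s n * ((t + u) ^+ 2 * K / 2 + e')).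
  by near: n.
have /andP[_ h2] : expR (s n * ((t - u) ^+ 2 * K / 2 - e')) <=
  Ex (p n) (fun x => expR ((t - u) * s n * Y n x)) <= expR (s n * ((t - u) ^+ 2 * K / 2 + e')).
  by near: n.
have h4 : 4 <= expR (s n * (2 * e')) by near: n; apply: speed_exp_ge; rewrite mulr_gt0.
have h5 : 8 <= expR (s n * 1) by near: n; apply: speed_exp_ge.
have h6 : 4 <= expR (s n * (eta / 2)) by near: n; apply: speed_exp_ge; rewrite divr_gt0.
have us0 : 0 <= u * s n by rewrite mulr_ge0 ?divr_ge0 ?ltW.
set pT := Ex _ _; set pZ := Ex _ _ in hZ.
pose a := expR (s n * (t * x0 + `|t| * r)).
(* Exponential tilting by [exp (t s Y)], which recentres [Y] at [x0]. *)
have main : Ex (p n) (fun x => expR (t * s n * Y n x)) <= a * (pT + pZ)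
    + expR (- (u * s n * (x0 + r))) * Ex (p n) (fun x => expR ((t + u) * s n * Y n x))
    + expR (u * s n * (x0 - r)) * Ex (p n) (fun x => expR ((t - u) * s n * Y n x)).
  clear h0 h1 h2 hZ h4 h5 h6 gap.
  rewrite /pT /pZ -ExD -!ExZ -!ExD; apply: le_Ex => // x.
  rewrite -!expRD; set A := expR (_ + _); set B := expR (_ + _).
  have [A0 B0] : 0 <= A /\ 0 <= B by rewrite !expR_ge0.
  have a0 : 0 <= a by rewrite expR_ge0.
  case: (leP (x0 + r) (Y n x)) => hx1.
    apply: (@le_trans _ _ A).
      by rewrite ler_expR; have := ler_wpM2l us0 hx1; lra.
    have : 0 <= a * ((`|Y n x + Z n x - x0| < delta)%R%:R + (delta / 2 <= `|Z n x|)%R%:R).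
      by rewrite mulr_ge0// addr_ge0.
    by lra.
  case: (leP (Y n x) (x0 - r)) => hx2.
    apply: (@le_trans _ _ B).
      by rewrite ler_expR; have := ler_wpM2l us0 hx2; lra.
    have : 0 <= a * ((`|Y n x + Z n x - x0| < delta)%R%:R + (delta / 2 <= `|Z n x|)%R%:R).
      by rewrite mulr_ge0// addr_ge0.
    by lra.
  have Yr : `|Y n x - x0| <= r by rewrite ler_norml; apply/andP; split; lra.
  apply: (@le_trans _ _ a).
    rewrite ler_expR -mulrA mulrCA ler_pM2l//.
    have : t * (Y n x - x0) <= `|t| * r.
      by apply: le_trans (ler_norm _) _; rewrite normrM ler_wpM2l.
    by lra.
  have : 1 <= (`|Y n x + Z n x - x0| < delta)%R%:R + (delta / 2 <= `|Z n x|)%R%:R :> R.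
    case: (leP (delta / 2) `|Z n x|) => hz; first by rewrite lerDr.
    rewrite (_ : `|Y n x + Z n x - x0| < delta); first by rewrite addr0.
    by have := ler_normD (Y n x - x0) (Z n x); rewrite addrAC; lra.
  by move=> /(ler_wpM2l a0); lra.
have tK : t * K = x0 by rewrite /t divfK// gt_eqF.
have uK : u * K = r by rewrite /u divfK// gt_eqF.
set E := expR (s n * (t ^+ 2 * K / 2 - e')) in h0.
have E1 : expR (- (u * s n * (x0 + r))) * expR (s n * ((t + u) ^+ 2 * K / 2 + e'))
    <= E / 4.
  rewrite -expRD ler_pdivlMr// -ler_pdivlMl ?expR_gt0// -expRN -expRD.
  apply: le_trans h4 _; rewrite ler_expR le_eqVlt; apply/orP; left; apply/eqP.
  by rewrite /t /u /e'; field; rewrite gt_eqF.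
have E2 : expR (u * s n * (x0 - r)) * expR (s n * ((t - u) ^+ 2 * K / 2 + e'))
    <= E / 4.
  rewrite -expRD ler_pdivlMr// -ler_pdivlMl ?expR_gt0// -expRN -expRD.
  apply: le_trans h4 _; rewrite ler_expR le_eqVlt; apply/orP; left; apply/eqP.
  by rewrite /t /u /e'; field; rewrite gt_eqF.
have m1 := ler_wpM2l (expR_ge0 (- (u * s n * (x0 + r)))) h1.
have m2 := ler_wpM2l (expR_ge0 (u * s n * (x0 - r))) h2.
have low : E / 2 <= a * (pT + pZ).
  by move: main m1 m2 E1 E2 h0; clear; lra.
pose q := expR (- (s n * (x0 ^+ 2 / (2 * K) + `|t| * r + e'))).
have qE : q * a = E.
  by rewrite /q /a /E -expRD; congr expR; rewrite /t; field; rewrite gt_eqF.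
have a0 : 0 < a by rewrite expR_gt0.
have low2 : q / 2 <= pT + pZ.
  by rewrite -(ler_pM2l a0) mulrA [a * q]mulrC qE.
have q8 : 8 * expR (- (s n * M)) <= q.
  have -> : q = expR (s n * 1) * expR (- (s n * M)).
    by rewrite /q -expRD; congr expR; rewrite /M; ring.
  by rewrite ler_wpM2r ?expR_ge0.
have q4 : 4 * expR (- (s n * (x0 ^+ 2 / (2 * K) + eta))) <= q.
  apply: le_trans (ler_wpM2r (expR_ge0 _) h6) _; rewrite -expRD ler_expR.
  by have := mulr_ge0 (ltW s0) gap; lra.
by move: low2 q8 q4 hZ; clear; lra.
Unshelve. all: by end_near. Qed.

End LaplaceTails.

(** * Size of the speed and of the error terms *)

Section Asymptotics.
Local Open Scope nat_scope.

Lemma leq_exp2rW (m n e : nat) : m <= n -> m ^ e <= n ^ e.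
Proof. by case: e => // e mn; rewrite leq_exp2r. Qed.

Lemma ffact_ge_exp (n m : nat) : (n - m) ^ m <= n ^_ m.
Proof.
elim: m => // m ih; rewrite ffactnSr expnSr; apply: leq_mul.
  by apply: leq_trans ih; apply/leq_exp2rW/leq_sub2l.
by rewrite leq_sub2l.
Qed.

Lemma ffact_le_exp (n m : nat) : n ^_ m <= n ^ m.
Proof.
by elim: m => // m ih; rewrite ffactnSr expnSr leq_mul// leq_subr.
Qed.

(** For [n >= 2k] every factor of the falling factorial is at least [n - k >= n / 2], and
    [n ^ 2 <= 4 * 'C(n, 2)]. *)
Lemma exp_le_ffact_bin2 (n k : nat) : 2 <= k -> 2 * k <= n ->
  n ^ k <= 2 ^ k * ((n - 2) ^_ (k - 2) * 'C(n, 2)).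
Proof.
move=> k2 kn.
have -> : n ^ k = n ^ (k - 2) * n ^ 2 by rewrite -expnD subnK.
have -> : 2 ^ k = 2 ^ (k - 2) * 2 ^ 2 by rewrite -expnD subnK.
rewrite mulnACA; apply: leq_mul.
  apply: leq_trans (leq_mul (leqnn _) (ffact_ge_exp _ _)).
  by rewrite -expnMn; apply: leq_exp2rW; lia.
case: n kn => [|n] kn; first lia.
by have := bin_ffact n.+1 2; rewrite ffactSS ffactn1 (_ : 2`! = 2)//; nia.
Qed.

Lemma sqr_bin_bin2_le (n k : nat) : 2 <= k -> 2 <= n ->
  'C(n - 2, k - 2) ^ 2 * 'C(n, 2) <= (n ^ (k - 1)) ^ 2.
Proof.
move=> k2 n2.
have -> : k - 1 = (k - 2) + 1 by lia.
rewrite expnD expn1 expnMn; apply: leq_mul.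
  apply: leq_exp2rW; apply: (@leq_trans ((n - 2) ^_ (k - 2))).
    by rewrite -bin_ffact leq_pmulr// fact_gt0.
  by apply: leq_trans (ffact_le_exp _ _) _; apply/leq_exp2rW/leq_subr.
apply: leq_trans (ffact_le_exp n 2).
by rewrite -bin_ffact leq_pmulr.
Qed.

End Asymptotics.

Section Scaling.
Variables (R : realType) (k : nat) (p beta : nat -> R).
Hypothesis k_ge3 : (3 <= k)%N.
Hypothesis p01 : forall n, 0 < p n < 1.
Hypothesis beta_gt0 : forall n, 0 < beta n.

Let q n := p n ^+ (k - 1) * Num.sqrt (p n * (1 - p n)).
Let u n := n%:R ^+ (k - 1) * p n ^+ (k - 1) * Num.sqrt (p n * (1 - p n)) / beta n.
Let v n := beta n / (n%:R ^+ k * q n ^+ 4).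

Hypothesis u0 : u @ \oo --> (0 : R).
Hypothesis v0 : v @ \oo --> (0 : R).

Definition mdp_speed n : R :=
  1 / ('C(n - 2, k - 2)%:R ^+ 2 * 'C(n, 2)%:R)
  * (1 / (p n ^+ (2 * k - 1) * (1 - p n))) * beta n ^+ 2.

Local Notation s := mdp_speed.
Let kap : R := ((k - 2)`!)%:R.
Let C n : R := 'C(n - 2, k - 2)%:R.
Let N n : R := 'C(n, 2)%:R.
Let M n : R := ((n - 2) ^_ (k - 2))%:R.
Let H n : R := ((k - 2) * (n - 3) ^_ (k - 3))%:R.

Let v_gt0 n : 0 < p n * (1 - p n).
Proof. by have /andP[h1 h2] := p01 n; rewrite mulr_gt0// subr_gt0. Qed.

Let q_gt0 n : 0 < q n.
Proof. by rewrite mulr_gt0 ?exprn_gt0 ?sqrtr_gt0//; have /andP[] := p01 n. Qed.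

Lemma sqr_q n : q n ^+ 2 = p n ^+ (2 * k - 1) * (1 - p n).
Proof.
rewrite /q exprMn sqr_sqrtr ?ltW// -exprM mulrA -exprSr.
by congr (_ ^+ _ * _); lia.
Qed.

Let q_le1 n : q n <= 1.
Proof.
have /andP[h1 h2] := p01 n.
rewrite -(@expr_le1 _ 2) ?(ltW (q_gt0 n))// sqr_q.
have h3 := ltW h1; have h4 := ltW h2.
by rewrite mulr_ile1 ?exprn_ge0 ?exprn_ile1 ?subr_ge0//; lra.
Qed.

Let kap_gt0 : 0 < kap. Proof. by rewrite ltr0n fact_gt0. Qed.

Let ME n : M n = C n * kap.
Proof. by rewrite /M -bin_ffact natrM. Qed.

Let C_gt0 n : (2 * k <= n)%N -> 0 < C n.
Proof. by move=> kn; rewrite ltr0n bin_gt0; lia. Qed.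

Let N_gt0 n : (2 * k <= n)%N -> 0 < N n.
Proof. by move=> kn; rewrite ltr0n bin_gt0; lia. Qed.

Lemma mdp_speedE n : s n = beta n ^+ 2 / (C n ^+ 2 * N n * q n ^+ 2).
Proof. by rewrite /s -sqr_q !div1r -invfM mulrC. Qed.

Let CN_gt0 n : (2 * k <= n)%N -> 0 < C n * N n.
Proof. by move=> kn; apply: mulr_gt0; [exact: C_gt0|exact: N_gt0]. Qed.

Let CNq_gt0 n j : (2 * k <= n)%N -> 0 < C n * N n * q n ^+ j.
Proof. by move=> kn; apply: mulr_gt0; [exact: CN_gt0|exact: exprn_gt0]. Qed.

Lemma mdp_speed_gt0 n : (2 * k <= n)%N -> 0 < s n.
Proof.
move=> kn; rewrite mdp_speedE; apply: divr_gt0; first exact: exprn_gt0.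
have -> : C n ^+ 2 * N n * q n ^+ 2 = C n * (C n * N n * q n ^+ 2) by ring.
by apply: mulr_gt0; [exact: C_gt0|exact: CNq_gt0].
Qed.

(** The variance of the linear part at parameter [s / beta]. The speed is normalised with
    ['C(n - 2, k - 2)] whereas an edge lies on [(n - 2) ^_ (k - 2)] cycles; the quotient [(k - 2)!]
    is the one in the rate function. *)
Lemma speed_gaussian n : (2 * k <= n)%N ->
  N n * ((s n / beta n) ^+ 2 * (p n ^+ (k - 1) * M n) ^+ 2 * (p n * (1 - p n)))
  = s n * kap ^+ 2.
Proof.
move=> kn; have C0 := C_gt0 kn; have N0 := N_gt0 kn.
have -> : (s n / beta n) ^+ 2 * (p n ^+ (k - 1) * M n) ^+ 2 * (p n * (1 - p n))
    = (s n / beta n) ^+ 2 * M n ^+ 2 * q n ^+ 2.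
  have -> : q n ^+ 2 = (p n ^+ (k - 1)) ^+ 2 * (p n * (1 - p n)).
    by rewrite /q exprMn sqr_sqrtr ?ltW.
  by ring.
by rewrite mdp_speedE ME; field; rewrite !gt_eqF ?q_gt0 ?beta_gt0.
Qed.

Let CN_ge n : (2 * k <= n)%N -> n%:R ^+ k <= 2 ^+ k * kap * (C n * N n).
Proof.
move=> kn; have := exp_le_ffact_bin2 (ltnW k_ge3) kn.
rewrite -(ler_nat R) natrX natrM natrX natrM -/(M n) -/(N n) ME; lra.
Qed.

Let q_pow_le n : q n ^+ 4 <= q n ^+ 2.
Proof. by apply: ler_wiXn2l; rewrite ?q_le1 ?ltW. Qed.

Let cst : R := 2 ^+ k * kap.
Let cst_gt0 : 0 < cst. Proof. by rewrite mulr_gt0// exprn_gt0. Qed.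

Let nk_gt0 n : (2 * k <= n)%N -> 0 < n%:R ^+ k :> R.
Proof. by move=> kn; rewrite exprn_gt0// ltr0n; lia. Qed.

Let inv_CN n : (2 * k <= n)%N -> beta n / (C n * N n * q n ^+ 4) <= cst * v n.
Proof.
move=> kn; have C0 := C_gt0 kn; have N0 := N_gt0 kn; have n0 := nk_gt0 kn.
rewrite /v ler_pdivrMr ?CNq_gt0//.
have -> : cst * (beta n / (n%:R ^+ k * q n ^+ 4)) * (C n * N n * q n ^+ 4)
  = beta n * ((cst * (C n * N n)) / n%:R ^+ k) by field; rewrite !gt_eqF ?q_gt0 ?beta_gt0.
by rewrite ler_peMr ?(ltW (beta_gt0 n))// ler_pdivlMr// mul1r; exact: CN_ge.
Qed.

Lemma increment_scale n : (2 * k <= n)%N -> s n / beta n * M n <= kap * cst * v n.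
Proof.
move=> kn; have C0 := C_gt0 kn; have N0 := N_gt0 kn.
rewrite -[leRHS]mulrA; apply: le_trans (ler_wpM2l (ltW kap_gt0) (inv_CN kn)).
have -> : s n / beta n * M n = kap * (beta n / (C n * N n * q n ^+ 2)).
  by rewrite mdp_speedE ME; field; rewrite !gt_eqF ?q_gt0 ?beta_gt0.
rewrite ler_pM2l// ler_pM2l// lef_pV2 ?posrE ?CNq_gt0//.
by rewrite ler_pM2l ?CN_gt0.
Qed.

(** Here the fourth power in the upper condition on [beta] is used in full: the left side equals
    [kap ^+ 3 * s] times [beta / (C * N * q ^+ 4)]. *)
Lemma cubic_error n : (2 * k <= n)%N ->
  N n * (s n / beta n * M n) ^+ 3 <= kap ^+ 3 * cst * v n * s n.
Proof.
move=> kn; have C0 := C_gt0 kn; have N0 := N_gt0 kn.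
have -> : N n * (s n / beta n * M n) ^+ 3
    = kap ^+ 3 * (beta n / (C n * N n * q n ^+ 4)) * s n.
  by rewrite mdp_speedE ME; field; rewrite !gt_eqF ?q_gt0 ?beta_gt0.
apply: ler_wpM2r; first exact/ltW/mdp_speed_gt0.
by rewrite -[leRHS]mulrA ler_pM2l ?exprn_gt0//; exact: inv_CN.
Qed.

Let HM n : (2 * k <= n)%N -> H n * (n - 2)%:R = (k - 2)%:R * M n.
Proof.
move=> kn; rewrite /H /M -!natrM; congr (_%:R).
have -> : (k - 2 = (k - 3).+1)%N by lia.
have -> : (n - 2 = (n - 3).+1)%N by lia.
by rewrite ffactSS -mulnA; congr (_ * _)%N; rewrite mulnC.
Qed.

(** [H / M = (k - 2) / (n - 2)] reduces the left side to a multiple of [s / ((n - 2) q^2)]. Since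
    [u * v = 1 / (n q^3)] is free of [beta] and [q <= 1], the product of the two hypotheses controls
    it. *)
Lemma overlap_error n : (2 * k <= n)%N ->
  N n * (s n / beta n) ^+ 2 * (M n * H n)
    <= 2 * kap ^+ 2 * (k - 2)%:R * (u n * v n) * s n.
Proof.
move=> kn; have C0 := C_gt0 kn; have N0 := N_gt0 kn; have nk0 := nk_gt0 kn.
have n20 : 0 < (n - 2)%:R :> R by rewrite ltr0n; lia.
have n0 : 0 < n%:R :> R by rewrite ltr0n; lia.
have HE : H n = (k - 2)%:R * M n / (n - 2)%:R by rewrite -HM// mulfK ?gt_eqF.
have -> : N n * (s n / beta n) ^+ 2 * (M n * H n)
   = kap ^+ 2 * (k - 2)%:R * (1 / ((n - 2)%:R * q n ^+ 2)) * s n.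
  by rewrite HE mdp_speedE ME; field; rewrite !gt_eqF ?q_gt0 ?beta_gt0.
have uv : u n * v n = 1 / (n%:R * q n ^+ 3).
  have -> : u n = n%:R ^+ (k - 1) * q n / beta n by rewrite /u /q mulrA.
  have nE : n%:R ^+ k = n%:R ^+ (k - 1) * n%:R :> R by rewrite -exprSr; congr (_ ^+ _); lia.
  by rewrite /v nE; field; rewrite !gt_eqF ?q_gt0 ?beta_gt0 ?exprn_gt0.
apply: ler_wpM2r; first exact/ltW/mdp_speed_gt0.
have -> : 2 * kap ^+ 2 * (k - 2)%:R * (u n * v n)
   = kap ^+ 2 * (k - 2)%:R * (2 * (u n * v n)) by ring.
apply: ler_wpM2l; first by rewrite mulr_ge0// sqr_ge0.
have D1 : 0 < (n - 2)%:R * q n ^+ 2 by apply: mulr_gt0 => //; exact: exprn_gt0.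
have D2 : 0 < n%:R * q n ^+ 3 by apply: mulr_gt0 => //; exact: exprn_gt0.
rewrite uv [leRHS]mulrA mulr1 ler_pdivrMr// mulrAC ler_pdivlMr// mul1r.
have nn : n%:R <= 2 * (n - 2)%:R :> R.
  by rewrite -natrM ler_nat; move: kn; clear -k_ge3; lia.
have -> : n%:R * q n ^+ 3 = n%:R * (q n ^+ 2 * q n) by ring.
rewrite [leRHS]mulrA; apply: ler_pM => //.
  by rewrite mulr_ge0 ?sqr_ge0// ltW.
by rewrite ler_piMr ?sqr_ge0.
Qed.

(** In [s * u ^+ 2] both [beta] and [q] cancel, leaving a ratio of powers of [n] and binomials that
    is at least 1; so [s >= 1 / u ^+ 2] and [u -> 0] suffices. *)
Lemma mdp_speed_cvg : s @ \oo --> +oo.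
Proof.
apply/cvgryPge => A; pose B := `|A| + 1.
have B1 : 1 <= B by rewrite lerDr.
have uB : \forall n \near \oo, `|u n| < B^-1.
  by move/cvgr0Pnorm_lt : u0; apply; rewrite invr_gt0; lra.
near=> n.
have kn : (2 * k <= n)%N by near: n; exact: nbhs_infty_ge.
have C0 := C_gt0 kn; have N0 := N_gt0 kn.
have n0 : 0 < n%:R ^+ (k - 1) :> R by rewrite exprn_gt0// ltr0n; lia.
have uE : u n = n%:R ^+ (k - 1) * q n / beta n by rewrite /u /q mulrA.
have up : 0 < u n by rewrite uE; apply: divr_gt0 => //; exact: mulr_gt0.
have uBn : u n < B^-1 by rewrite -[u n]gtr0_norm//; near: n.
have s1 : 1 <= s n * u n ^+ 2.
  have -> : s n * u n ^+ 2 = (n%:R ^+ (k - 1)) ^+ 2 / (C n ^+ 2 * N n).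
    by rewrite uE mdp_speedE; field; rewrite !gt_eqF ?q_gt0 ?beta_gt0.
  rewrite ler_pdivlMr ?(mulr_gt0 (exprn_gt0 2 C0) N0)// mul1r -!natrX -natrM ler_nat.
  by apply: sqr_bin_bin2_le; [exact: ltnW|move: kn; clear -k_ge3; lia].
have uB1 : u n * B <= 1 by rewrite -ler_pdivlMr ?div1r ?ltW//; lra.
have s0 : 0 <= s n by exact/ltW/mdp_speed_gt0.
have AB : A <= B by have := ler_norm A; rewrite /B; lra.
have BB : B <= B ^+ 2 by rewrite expr2 ler_peMr//; lra.
have B2 : 0 <= B ^+ 2 by exact: sqr_ge0.
have h1 := ler_wpM2r B2 s1.
have h2 : (u n * B) ^+ 2 <= 1 by rewrite expr_le1// mulr_ge0; lra.
have h3 := ler_wpM2l s0 h2.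
by rewrite exprMn in h3; lra.
Unshelve. all: by end_near. Qed.

Lemma mdp_speed_errors (e : R) : 0 < e -> \forall n \near \oo,
  [/\ (2 * k <= n)%N, 0 < s n, s n / beta n * M n <= e,
      N n * (s n / beta n * M n) ^+ 3 <= e * s n &
      N n * (s n / beta n) ^+ 2 * (M n * H n) <= e * s n].
Proof.
move=> e0; pose B := kap * cst + kap ^+ 3 * cst + 2 * kap ^+ 2 * (k - 2)%:R.
have B0 : 0 < B.
  have k20 : 0 <= (k - 2)%:R :> R by [].
  have h1 : 0 < kap * cst by rewrite mulr_gt0.
  have h2 : 0 < kap ^+ 3 * cst by apply: mulr_gt0 => //; exact: exprn_gt0.
  have h3 : 0 <= 2 * kap ^+ 2 * (k - 2)%:R.
    by apply: mulr_ge0 => //; apply: mulr_ge0 => //; exact: sqr_ge0.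
  by rewrite /B; lra.
have eB : 0 < e / B by rewrite divr_gt0.
have v1 : \forall n \near \oo, `|v n| < e / B by move/cvgr0Pnorm_lt : v0; apply.
have u1 : \forall n \near \oo, `|u n| < 1 by move/cvgr0Pnorm_lt : u0; apply.
near=> n.
have kn : (2 * k <= n)%N by near: n; exact: nbhs_infty_ge.
have C0 := C_gt0 kn; have N0 := N_gt0 kn; have nk0 := nk_gt0 kn.
have vp : 0 < v n by apply: divr_gt0 => //; apply: mulr_gt0 => //; exact: exprn_gt0.
have vB : v n < e / B by rewrite -[v n]gtr0_norm//; near: n.
have vBe : v n * B <= e by rewrite -ler_pdivlMr// ltW.
have uv : u n * v n <= v n.
  have : u n <= 1 by apply: le_trans (ler_norm _) _; apply: ltW; near: n.
  by move=> h; rewrite ler_piMl// ltW.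
have s0 := mdp_speed_gt0 kn.
have k20 : 0 <= (k - 2)%:R :> R by [].
have h1 : 0 <= v n * (kap * cst) by apply/ltW/mulr_gt0 => //; exact: mulr_gt0.
have h2 : 0 <= v n * (kap ^+ 3 * cst).
  by apply/ltW/mulr_gt0 => //; apply: mulr_gt0 => //; exact: exprn_gt0.
have h3' : 0 <= 2 * kap ^+ 2 * (k - 2)%:R.
  by apply: mulr_ge0 => //; apply: mulr_ge0 => //; exact: sqr_ge0.
have h3 := mulr_ge0 (ltW vp) h3'.
have h4 := ler_wpM2l h3' uv.
move: vBe; rewrite /B => vBe.
split=> //.
- by apply: le_trans (increment_scale kn) _; lra.
- by apply: le_trans (cubic_error kn) _; apply: ler_wpM2r; [exact: ltW|lra].
- by apply: le_trans (overlap_error kn) _; apply: ler_wpM2r; [exact: ltW|lra].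
Unshelve. all: by end_near. Qed.

End Scaling.

(** * Laplace asymptotics of the linear part and the remainder of the cycle count *)

Section CycleLaplace.
Variables (R : realType) (k : nat) (p beta : nat -> R).
Hypothesis k_ge3 : (3 <= k)%N.
Hypothesis p01 : forall n, 0 < p n < 1.
Hypothesis beta_gt0 : forall n, 0 < beta n.
Hypothesis beta_lower : much_less
  (fun n => n%:R ^+ (k - 1) * p n ^+ (k - 1) * Num.sqrt (p n * (1 - p n))) beta.
Hypothesis beta_upper : much_less beta
  (fun n => n%:R ^+ k * (p n ^+ (k - 1) * Num.sqrt (p n * (1 - p n))) ^+ 4).

Let M n := ((n - 2) ^_ (k - 2))%N.
Let H n := ((k - 2) * (n - 3) ^_ (k - 3))%N.
Local Notation s := (mdp_speed k p beta).
Local Notation kap := (((k - 2)`!)%:R : R).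

Let p01W n : 0 <= p n <= 1.
Proof. by have /andP[h1 h2] := p01 n; rewrite !ltW. Qed.

Definition cycle_lin n (x : {set edge n}) : R := hlin (p n) k (M n) x / beta n.
Definition cycle_rem n (x : {set edge n}) : R :=
  hrem (p n) (cycle_family n k) k (M n) x / beta n.

Let errors := mdp_speed_errors k_ge3 p01 beta_gt0 beta_lower beta_upper.

Let scaleE (t : R) n : 0 < s n ->
  `|t * s n / beta n| * (M n)%:R = `|t| * (s n / beta n * (M n)%:R).
Proof.
move=> s0; have -> : t * s n / beta n = t * (s n / beta n) by rewrite mulrA.
by rewrite normrM (gtr0_norm (divr_gt0 s0 (beta_gt0 n))) [RHS]mulrA.
Qed.

Lemma laplace_cycle_lin (t eta : R) : 0 < eta -> \forall n \near \oo,
  expR (s n * (t ^+ 2 * kap ^+ 2 / 2 - eta))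
    <= Ex (p n) (fun x : {set edge n} => expR (t * s n * cycle_lin x))
    <= expR (s n * (t ^+ 2 * kap ^+ 2 / 2 + eta)).
Proof.
move=> eta0; pose a := `|t| + 1; have a0 : 0 < a by rewrite ltr_wpDl.
have ta : `|t| <= a by rewrite lerDl.
(* The first bound makes the parameter admissible for the Bernoulli expansion, the second keeps
   [4 * N * (|t| * w) ^+ 3] below [s * eta]. Using [a = |t| + 1] avoids dividing by zero. *)
pose e := Num.min (8 * a)^-1 (eta / (4 * a ^+ 3)).
have e0 : 0 < e.
  by rewrite lt_min invr_gt0 mulr_gt0// divr_gt0// mulr_gt0// exprn_gt0.
have e1 : e * (8 * a) <= 1 by rewrite -ler_pdivlMr ?mulr_gt0// div1r /e ge_min lexx.
have e2 : e * (4 * a ^+ 3) <= eta.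
  by rewrite -ler_pdivlMr ?mulr_gt0 ?exprn_gt0// /e ge_min lexx orbT.
apply: filterS (errors e0) => n [kn s0 he hN _].
set w := s n / beta n * (M n)%:R in he hN.
have w0 : 0 <= w by rewrite mulr_ge0 ?divr_ge0// ltW.
have tw : `|t * s n / beta n| * (M n)%:R <= 8^-1.
  rewrite scaleE// -/w.
  have h1 := ler_wpM2r w0 ta; have h2 := ler_wpM2l (ltW a0) he; lra.
have := Ex_exp_hlin_bounds (edge n) (p01W n) k tw.
rewrite scaleE// -/w card_edge.
have -> : Ex (p n) (fun x : {set edge n} => expR (t * s n / beta n * hlin (p n) k (M n) x))
    = Ex (p n) (fun x : {set edge n} => expR (t * s n * cycle_lin x)).
  by apply: eq_Ex => x; congr expR; rewrite /cycle_lin; ring.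
have sg := speed_gaussian k_ge3 p01 beta_gt0 kn.
have -> : (t * s n / beta n) ^+ 2 * hslope (p n) k (M n) ^+ 2 * (p n * (1 - p n)) / 2
  = t ^+ 2 / 2 * ((s n / beta n) ^+ 2 * (p n ^+ (k - 1) * (M n)%:R) ^+ 2
      * (p n * (1 - p n))).
  by rewrite /hslope; field; rewrite gt_eqF.
set g := (s n / beta n) ^+ 2 * _ * _.
have gE : 'C(n, 2)%:R * g = s n * kap ^+ 2 by [].
have err : 'C(n, 2)%:R * (4 * (`|t| * w) ^+ 3) <= s n * eta.
  have t3 : `|t| ^+ 3 <= a ^+ 3 by rewrite lerXn2r ?nnegrE// ltW.
  have Nw : 0 <= 'C(n, 2)%:R * w ^+ 3 by rewrite mulr_ge0 ?exprn_ge0.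
  have h1 := ler_wpM2l Nw t3.
  have h2 := ler_wpM2l (exprn_ge0 3 (ltW a0)) hN.
  have h3 := ler_wpM2l (ltW s0) e2.
  rewrite exprMn; lra.
have NgE : 'C(n, 2)%:R * (t ^+ 2 / 2 * g) = t ^+ 2 / 2 * (s n * kap ^+ 2).
  by rewrite mulrCA gE.
move=> /andP[l u]; apply/andP; split.
  by apply: le_trans l; rewrite ler_expR [leRHS]mulrBr NgE; lra.
by apply: le_trans u _; rewrite ler_expR [leLHS]mulrDr NgE; lra.
Qed.

Lemma laplace_cycle_rem (t eta : R) : 0 < eta -> \forall n \near \oo,
  Ex (p n) (fun x : {set edge n} => expR (t * s n * cycle_rem x))
    <= expR (s n * eta).
Proof.
move=> eta0; pose a := `|t| + 1; have a0 : 0 < a by rewrite ltr_wpDl.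
have ta : `|t| <= a by rewrite lerDl.
have kr0 : 0 < k%:R :> R by rewrite ltr0n; lia.
(* The bound 1 gives [w <= 1], so that the quartic term [w * (N * w ^+ 3)] is no larger than the
   cubic one; the second makes the parameter admissible; the last two each confine one error term to
   half of [s * eta]. *)
pose e := Num.min (Num.min 1 (4 * k%:R * a)^-1)
   (Num.min (eta / (4 * a ^+ 2 * k%:R)) (eta / (64 * a ^+ 4 * k%:R ^+ 2))).
have d1 : 0 < 4 * k%:R * a by apply: mulr_gt0 => //; exact: mulr_gt0.
have d2 : 0 < 4 * a ^+ 2 * k%:R.
  by apply: mulr_gt0 => //; apply: mulr_gt0 => //; exact: exprn_gt0.
have d3 : 0 < 64 * a ^+ 4 * k%:R ^+ 2.
  by apply: mulr_gt0; [apply: mulr_gt0 => //|]; exact: exprn_gt0.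
have e0 : 0 < e by rewrite !lt_min ltr01 invr_gt0 d1 !divr_gt0.
have e1 : e <= 1 by rewrite /e !ge_min lexx.
have e2 : e * (4 * k%:R * a) <= 1 by rewrite -ler_pdivlMr// div1r /e !ge_min lexx ?orbT.
have e3 : e * (4 * a ^+ 2 * k%:R) <= eta by rewrite -ler_pdivlMr// /e !ge_min lexx ?orbT.
have e4 : e * (64 * a ^+ 4 * k%:R ^+ 2) <= eta.
  by rewrite -ler_pdivlMr// /e !ge_min lexx ?orbT.
apply: filterS (errors e0) => n [kn s0 he hN hH].
set w := s n / beta n * (M n)%:R in he hN.
have w0 : 0 <= w by rewrite mulr_ge0 ?divr_ge0// ltW.
have tw : 4 * k%:R * `|t * s n / beta n| * (M n)%:R <= 1.
  rewrite -mulrA scaleE// -/w.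
  have h1 := ler_wpM2r w0 ta; have h2 := ler_wpM2l (ltW a0) he.
  have k4 : 0 <= 4 * k%:R :> R by rewrite mulr_ge0.
  have := ler_wpM2l k4 (le_trans h1 h2); lra.
have k0 : (0 < k)%N by exact: leq_trans k_ge3.
have := Ex_exp_hrem_le (p01W n) k0 (cycle_family_card k_ge3)
  (cycle_family_deg k_ge3) (cycle_family_codeg k_ge3) tw.
have -> : Ex (p n) (fun x : {set edge n} => expR (t * s n / beta n
      * hrem (p n) (cycle_family n k) k (M n) x))
    = Ex (p n) (fun x : {set edge n} => expR (t * s n * cycle_rem x)).
  by apply: eq_Ex => x; congr expR; rewrite /cycle_rem; ring.
move=> h; apply: le_trans h _; rewrite ler_expR card_edge.
have t2 : t ^+ 2 <= a ^+ 2.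
  by rewrite -[t ^+ 2]real_normK ?num_real// lerXn2r ?nnegrE// ltW.
have t4 : t ^+ 4 <= a ^+ 4.
  have -> : t ^+ 4 = (t ^+ 2) ^+ 2 by rewrite -exprM.
  have -> : a ^+ 4 = (a ^+ 2) ^+ 2 by rewrite -exprM.
  by rewrite lerXn2r ?nnegrE ?sqr_ge0.
set P1 := 2 * _ * _ * _; set P2 := 32 * _ * _ * _ * _.
have -> : P1 = 2 * k%:R * t ^+ 2 *
    ('C(n, 2)%:R * (s n / beta n) ^+ 2 * ((M n)%:R * (H n)%:R)).
  by rewrite /P1 /M /H; field; rewrite gt_eqF.
have -> : P2 = 32 * k%:R ^+ 2 * t ^+ 4 * (w * ('C(n, 2)%:R * w ^+ 3)).
  by rewrite /P2 /w /M; field; rewrite gt_eqF.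
have b1 : 2 * k%:R * t ^+ 2 *
    ('C(n, 2)%:R * (s n / beta n) ^+ 2 * ((M n)%:R * (H n)%:R)) <= s n * (eta / 2).
  apply: (@le_trans _ _ (2 * k%:R * a ^+ 2 * (e * s n))).
    have p1 : 0 <= 2 * k%:R * t ^+ 2 by rewrite mulr_ge0 ?sqr_ge0// mulr_ge0.
    have p2 : 0 <= 'C(n, 2)%:R * (s n / beta n) ^+ 2 * ((M n)%:R * (H n)%:R).
      by apply: mulr_ge0; [apply: mulr_ge0 => //; exact: sqr_ge0|exact: mulr_ge0].
    by apply: ler_pM => //; rewrite ler_pM2l// mulr_gt0.
  have := ler_wpM2l (ltW s0) e3; lra.
have b2 : 32 * k%:R ^+ 2 * t ^+ 4 * (w * ('C(n, 2)%:R * w ^+ 3)) <= s n * (eta / 2).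
  have Nw : 0 <= 'C(n, 2)%:R * w ^+ 3 by rewrite mulr_ge0 ?exprn_ge0.
  apply: (@le_trans _ _ (32 * k%:R ^+ 2 * a ^+ 4 * (1 * (e * s n)))).
    have p1 : 0 <= 32 * k%:R ^+ 2 * t ^+ 4.
      by rewrite mulr_ge0 ?exprn_even_ge0// mulr_ge0// sqr_ge0.
    have p2 : 0 <= w * ('C(n, 2)%:R * w ^+ 3) by rewrite mulr_ge0.
    apply: ler_pM => //; first by rewrite ler_pM2l// mulr_gt0// exprn_gt0.
    by apply: ler_pM => //; exact: le_trans he e1.
  have := ler_wpM2l (ltW s0) e4; lra.
lra.
Qed.

End CycleLaplace.

Theorem theorem1p5 (R : realType) (k : nat) (hk : (3 <= k)%N)
  (d : nat -> measure_display) (Omega : forall n, measurableType (d n))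
  (P : forall n, probability (Omega n) R)
  (p : nat -> R) (hp : forall n, 0 < p n < 1)
  (X : forall n, 'M[{RV (P n) >-> R}]_n)
  (Xsym : forall n, (X n)^T = X n)
  (Xindep : forall n,
     mutually_independent (P n) [set ij : 'I_n * 'I_n | (ij.1 < ij.2)%N]%SET
       (fun ij w => X n ij.1 ij.2 w))
  (Xbernoulli1 : forall n (i j : 'I_n), (i < j)%N ->
     P n (X n i j @^-1` [set 1]) = (p n)%:E)
  (Xbernoulli0 : forall n (i j : 'I_n), (i < j)%N ->
     P n (X n i j @^-1` [set 0]) = (1 - p n)%:E)
  (Xdiag : forall n (i : 'I_n), P n (X n i i @^-1` [set 0]) = 1%E)
  (beta : nat -> R) (beta_gt0 : forall n, 0 < beta n)
  (beta_incr : nondecreasing_seq beta)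
  (beta_lower : much_less
     (fun n => n%:R ^+ (k - 1) * p n ^+ (k - 1) * Num.sqrt (p n * (1 - p n)))
     beta)
  (beta_upper : much_less beta
     (fun n => n%:R ^+ k
               * (p n ^+ (k - 1) * Num.sqrt (p n * (1 - p n))) ^+ 4)) :
  let Tr n (w : Omega n) : R := cycle_trace k (\matrix_(i, j) X n i j w) in
  let T n (w : Omega n) : R :=
    (Tr n w - fine 'E_(P n)[Tr n]) / (2 * beta n) in
  let s n : R :=
    1 / ('C(n - 2, k - 2)%:R ^+ 2 * 'C(n, 2)%:R)
    * (1 / (p n ^+ (2 * k - 1) * (1 - p n))) * beta n ^+ 2 in
  LDP P T s (fun x => (x ^+ 2 / (2 * ((k - 2)`!)%:R ^+ 2))%:E).
Proof.
move=> Tr T s.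
have p01 n : 0 <= p n <= 1 by have /andP[h1 h2] := hp n; rewrite !ltW.
pose conf n := edge_conf (X n).
have mconf n x : measurable (conf n @^-1` [set x]) by exact: measurable_edge_conf.
have Pconf n x : P n (conf n @^-1` [set x]) = (weight (p n) x)%:E.
  exact: probability_edge_conf (@Xindep n) (@Xbernoulli1 n) x.
pose F n := cycle_family n k.
have TrE n : @Tr n = (fun x => 2 * hcount R (F n) x) \o conf n.
  apply/funext => w; rewrite /Tr /cycle_trace cycle_countE//=; congr (2 * _).
  rewrite -sum1_card natr_sum /hcount big_mkcond [RHS]big_mkcond.
  apply: eq_bigr => S _; rewrite inE.
  have -> : [set e | (\matrix_(i, j) X n i j w) (val e).1 (val e).2 == 1]%SET = conf n w.
    by apply/setP => e; rewrite !inE mxE.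
  by case: (S \in F n) => //=; case: (S \subset _).
pose Y n (x : {set edge n}) : R := cycle_lin k p beta x.
pose Z n (x : {set edge n}) : R := cycle_rem k p beta x.
(* The factor 2 of the trace cancels the one in [2 * beta n], and the centred count is the linear
   part plus the remainder by definition of [hrem]. *)
have TE n : @T n = (fun x => Y n x + Z n x) \o conf n.
  apply/funext => w; rewrite /T TrE (expectation_conf (mconf n) (@Pconf n)) /=; last first.
    by move=> x; apply: mulr_ge0 => //; apply: sumr_ge0 => S _; exact: ler0n.
  rewrite -/(Ex (p n) (fun x => 2 * hcount R (F n) x)) ExZ.
  rewrite /Y /Z /cycle_lin /cycle_rem /hrem.
  by field; rewrite gt_eqF.
have TP n (B : set R) : P n (@T n @^-1` B) =
    (Ex (p n) (fun x => (x \in [set x | B (Y n x + Z n x)])%:R))%:E.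
  by rewrite TE comp_preimage (probability_conf (mconf n) (@Pconf n)).
have K0 : 0 < ((k - 2)`!)%:R ^+ 2 :> R by rewrite exprn_gt0// ltr0n fact_gt0.
have soo : s @ \oo --> +oo := mdp_speed_cvg hk hp beta_gt0 beta_lower.
have lY := laplace_cycle_lin hk hp beta_gt0 beta_lower beta_upper.
have lZ := laplace_cycle_rem hk hp beta_gt0 beta_lower beta_upper.
apply: LDP_gaussian => //.
- by move=> n; rewrite TE; exact: (measurable_fun_conf (mconf n)).
- move=> m eta m0 eta0.
  apply: filterS (tail_upper p01 K0 soo lY lZ m0 eta0) => n h B mB Bm.
  rewrite TP lee_fin; apply: le_trans h; apply: le_Ex => // x.
  rewrite ler_nat; case: (boolP (x \in _)) => // /set_mem /Bm.
  by rewrite /Y /Z => ->.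
- move=> x0 delta eta delta0 eta0.
  apply: filterS (tail_lower p01 K0 soo lY lZ x0 delta0 eta0) => n h B mB Bx.
  rewrite TP lee_fin; apply: le_trans h _; apply: le_Ex => // x.
  rewrite ler_nat; case: ltP => // h; rewrite mem_set//.
  exact: Bx.
Qed.
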